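(* Let $U\subseteq\mathbb{R}$ be an open interval and let $f:U\to\mathbb{R}$ be a real-analytic function that is not the restriction to $U$ of a rational function in $\mathbb{R}(x)$. Let $I_*\subset U$ be a nondegenerate compact interval and let $m_*,M_*$ be constants with $$0<m_*\le|f'(x)|\le M_*\qquad(x\in I_* ).$$ There exists a constant $C_{\mathrm{low}}>0$, depending only on $f,I_*,m_*,M_*$ (and on the fixed numerical parameter $\tau=100$), with the following property. Let $J\subseteq I_*$ be a nondegenerate compact interval and let $A\ge3$ be an integer. Assume that $$W_d(x)\ne0\qquad\text{for all }x\in J\text{ and all integers }2\le d\le D(A).$$ Then there exist constants $C(J,A)>0$ and $Q_0(J,A)\in\mathbb{Z}_{>0}$, independent of $H$, such that for every integer $H\ge2$ and every integer $Q\ge Q_0(J,A)$ one has $$\#\mathcal{D}(J;Q,A,H)\le C_{\mathrm{low}}\,Q^2H^{-98}+C(J,A)\,Q^{17/10}.$$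
   Context: Fix $\tau=100$. For an integer $A\ge3$ put $D(A):=\max\{2,\lceil 10A/97\rceil\}$, and for $Q\ge2$ put $T(Q,A):=Q^{A/97}$. For an integer $d\ge0$, $W_d$ denotes the Wronskian on $U$ of the $N_d=2(d+1)$ functions $x^i f(x)^j$, $0\le i\le d$, $j\in\{0,1\}$, ordered lexicographically in $(i,j)$; here the Wronskian of $\phi_1,\dots,\phi_N$ is $\det(\phi_j^{(k-1)}(x))_{1\le k,j\le N}$. For a nondegenerate compact interval $J\subseteq I_*$ and integers $A\ge3$, $H\ge2$, $Q\ge2$, $\mathcal{D}(J;Q,A,H)$ is the set of rational numbers $p/q\in J$ with $\gcd(p,q)=1$ and $Q\le q<2Q$ for which there exist $a\in\mathbb{Z}$ and $b\in\mathbb{Z}_{>0}$ with $H\le b<T(Q,A)$ and $$|f(p/q)-a/b|\le 2b^{-\tau}+4M_*Q^{-A}.$$ (The fraction $a/b$ need not be reduced.) *)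

(* Defs.v *)
From HB Require Import structures.
From mathcomp Require Import all_boot all_order all_algebra.
From mathcomp Require Import finmap.
From mathcomp Require Import all_classical all_reals all_analysis.

Set Implicit Arguments.
Unset Strict Implicit.
Unset Printing Implicit Defensive.

Import Order.TTheory GRing.Theory Num.Theory.
Import numFieldNormedType.Exports.

Local Open Scope classical_set_scope.
Local Open Scope ring_scope.

Definition tau : nat := 100.

Definition Dpar (A : nat) : nat :=
  maxn 2 `|Num.ceil ((10 * A)%:R / 97%:R : rat)|%N.

Definition Tpar (R : realType) (Q A : nat) : R :=
  Q%:R `^ (A%:R / 97%:R).

Definition real_analytic_on (R : realType) (U : set R) (f : R -> R) : Prop :=
  forall x0, U x0 -> exists a : R ^nat,
    \forall x \near x0, pseries a (x - x0) @ \oo --> f x.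

(* The rational function has no pole on U. *)
Definition rational_on (R : realType) (U : set R) (f : R -> R) : Prop :=
  exists p q : {poly R},
    forall x, U x -> q.[x] != 0 /\ f x = p.[x] / q.[x].

Definition wronskian (R : realType) (N : nat) (phi : 'I_N -> R -> R) (x : R) : R :=
  \det (\matrix_(k < N, j < N) derive1n k (phi j) x).

(* The lexicographic order on the pairs (i, j), 0 <= i <= d, j in {0, 1},
   lists (i, j) at position n = 2 i + j. *)
Definition W (R : realType) (f : R -> R) (d : nat) : R -> R :=
  wronskian (fun (n : 'I_(2 * d.+1)) (x : R) => x ^+ (n %/ 2) * f x ^+ (n %% 2)).

Definition Dset (R : realType) (f : R -> R) (M : R) (J : set R) (Q A H : nat) :
    set R :=
  [set x | J x /\
    exists (p : int) (q : nat),
      [/\ x = p%:~R / q%:R, coprime `|p|%N q, (Q <= q < 2 * Q)%N &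
        exists (a : int) (b : nat),
          [/\ (0 < b)%N, (H <= b)%N, b%:R < Tpar R Q A &
            `|f x - a%:~R / b%:R| <= 2 * b%:R ^- tau + 4 * M * Q%:R ^- A]]].

(* Main.v *)
Require Import Defs.
From HB Require Import structures.
From mathcomp Require Import all_boot all_order all_algebra.
From mathcomp Require Import finmap.
From mathcomp Require Import perm ring lra zify.
From mathcomp Require Import all_classical all_reals all_analysis.

Set Implicit Arguments.
Unset Strict Implicit.
Unset Printing Implicit Defensive.

Import Order.TTheory GRing.Theory Num.Theory.
Import numFieldNormedType.Exports.

Local Open Scope classical_set_scope.
Local Open Scope ring_scope.

(* Denominators b with b^5 <= Q^4 are treated one fraction a/b at a time: since
   |f'| >= m, the x with f(x) within delta of a/b lie in an interval of length
   O(delta / m), and fractions with denominator < 2Q are 1/(4Q^2)-separated.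
   Summing over the O(b) numerators gives Q^2 H^(-98) and an O(Q^(17/10)) term.

   The remaining b satisfy Q^(2d) <= b^5 <= Q^(2d+2) for some 2 <= d <= D(A).
   Put N = 2(d+1) and take N such points p/q in an interval of length Q^(-17/10).
   Newton's divided differences factor the determinant of the monomials
   (p/q)^i (a/b)^j as the Vandermonde determinant of the points times a
   determinant close to W_d / prod_k k!; the perturbation a/b - f(p/q), of size
   O(Q^(-38d)), only costs a factor O(Q^2) per divided difference. So the
   determinant is nonzero, yet too small to be a nonzero rational number with
   denominator prod q^d b. Hence such an interval contains fewer than N points. *)

(** * Analytic functions: termwise differentiation and monomials in x and f *)

Section analytic.
Context {R : realType}.
Implicit Types (U : set R) (f g : R -> R) (c : R ^nat).

(* The weight (i+1) |x|^i is absorbed by (r - |x|)^-1 r^(i+1) for |x| < r < |K|. *)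
Lemma is_cvg_pseries_diffs_inside c (K x : R) :
  cvgn (pseries c K) -> `|x| < `|K| -> cvgn (pseries (pseries_diffs c) x).
Proof.
move=> cK xK; pose r := (`|x| + `|K|) / 2.
have xr : `|x| < r by rewrite /r; lra.
have rK : r < `|K| by rewrite /r; lra.
have r0 : 0 <= r by rewrite (le_trans _ (ltW xr)).
have xrX i : i.+1%:R * `|x| ^+ i <= r ^+ i.+1 / (r - `|x|).
  rewrite ler_pdivlMr ?subr_gt0//.
  suff : i.+1%:R * `|x| ^+ i * (r - `|x|) <= r ^+ i.+1 - `|x| ^+ i.+1.
    by move=> /le_trans; apply; rewrite gerBl exprn_ge0.
  rewrite subrXX mulrC ler_wpM2l ?subr_ge0 ?(ltW xr)// mulr_natl.
  rewrite -[in leLHS](card_ord i.+1) -sumr_const ler_sum// => j _.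
  rewrite -[in leLHS](subnK (ltn_ord j : (j <= i)%N)) exprD /=.
  by rewrite ler_wpM2r ?exprn_ge0// lerXn2r ?nnegrE// ltW.
apply: normed_cvg; apply: (@series_le_cvg _ _
    (fun i => (r - `|x|)^-1 * (`|c i.+1| * r ^+ i.+1))) => [i|i|i|] /=.
- exact: normr_ge0.
- by rewrite !mulr_ge0 ?invr_ge0 ?subr_ge0 ?exprn_ge0// ltW.
- rewrite /pseries_diffs !normrM normr_nat normrX.
  have := ler_wpM2l (normr_ge0 (c i.+1)) (xrX i); lra.
- have : cvgn (pseries (fun i => `|c i|) r).
    by apply: is_cvg_pseries_inside_norm cK _; rewrite ger0_norm.
  rewrite /pseries => cr.
  apply: is_cvg_seriesZ.
  have -> : series (fun i => `|c i.+1| * r ^+ i.+1) =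
      (fun n => series (fun i => `|c i| * r ^+ i) n.+1 - `|c 0%N|).
    apply/funext => n; rewrite /series/= big_nat_recl//= expr0 mulr1.
    by rewrite [X in X - _]addrC addrK.
  apply: is_cvgB; last exact: is_cvg_cst.
  by apply/cvg_ex; exists (limn (series (fun i => `|c i| * r ^+ i)));
    rewrite (cvg_shiftS (series (fun i => `|c i| * r ^+ i))).
Qed.

(** Both conclusions follow from one fact: near [x0] the differentiated series converges and its sum
    is the derivative of [f]. *)
Lemma analytic_derive U f : real_analytic_on U f ->
  (forall x, U x -> derivable f x 1) /\ real_analytic_on U (f^`())%classic.
Proof.
move=> fU.
suff H x0 : U x0 -> exists c : R ^nat, \forall x \near x0,
    is_derive (x : R) (1 : R) f (limn (pseries (pseries_diffs c) (x - x0))) /\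
    cvgn (pseries (pseries_diffs c) (x - x0)).
  split=> [x0 /H[c nc]|x0 /H[c nc]].
    by have [[]] := nbhs_singleton nc.
  exists (pseries_diffs c); apply: filterS nc => x [[_ dx] cx].
  by rewrite derive1E dx.
move=> /fU[c /nbhs_ballP[e /= e0 ec]]; exists c.
pose K := e / 2.
have K0 : 0 < K by rewrite divr_gt0.
have cK : cvgn (pseries c K).
  have /ec : ball x0 e (x0 + K).
    by rewrite /ball/= opprD addrA subrr sub0r normrN gtr0_norm// /K; lra.
  by rewrite [x0 + K]addrC addrK => /cvgP.
(* Termwise differentiation asks for convergence of the series and of its first two derived series
   at one point. Each derivation costs some radius, hence the nested radii [K2 < K1 < K < e]. *)
pose K1 := K / 2; pose K2 := K / 3.
have cd (x : R) : `|x| < K -> cvgn (pseries (pseries_diffs c) x).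
  by move=> xK; apply: is_cvg_pseries_diffs_inside cK _; rewrite (gtr0_norm K0).
have cdd (x : R) : `|x| < K1 -> cvgn (pseries (pseries_diffs (pseries_diffs c)) x).
  move=> xK; apply: is_cvg_pseries_diffs_inside (cd K1 _) _.
    by rewrite gtr0_norm /K1; lra.
  by rewrite (gtr0_norm (_ : 0 < K1)) // /K1; lra.
have K20 : 0 < K2 by rewrite /K2; lra.
have K2c : cvgn (pseries c K2).
  by apply: is_cvg_pseries_inside cK _; rewrite !gtr0_norm // /K2; lra.
have K2d : cvgn (pseries (pseries_diffs c) K2).
  by apply: cd; rewrite gtr0_norm// /K2; lra.
have K2dd : cvgn (pseries (pseries_diffs (pseries_diffs c)) K2).
  by apply: cdd; rewrite gtr0_norm// /K2 /K1; lra.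
have nearx0 : \forall x \near x0, `|x - x0| < K2.
  by apply/nbhs_ballP; exists K2 => //= x; rewrite /ball/= distrC.
near=> x.
have xK : `|x - x0| < K2 by near: x.
split; last by apply: cd; rewrite (lt_trans xK)// /K2; lra.
have D : is_derive (x - x0) (1 : R) (fun y => limn (pseries c y))
    (limn (pseries (pseries_diffs c) (x - x0))).
  by apply: pseries_snd_diffs K2c K2d K2dd _; rewrite (gtr0_norm K20).
have Dx : is_derive x (1 : R) (fun y : R => y - x0) 1.
  by apply: (is_derive_eq (is_deriveB _ _)); rewrite subr0.
have := @is_derive1_comp _ (fun y => limn (pseries c y)) (fun y : R => y - x0) x _ _ D Dx.
rewrite mulr1; apply: near_eq_is_derive.
have nx : \forall y \near x, `|y - x0| < e.
  have : open (ball x0 e) by exact: ball_open.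
  rewrite openE => /(_ x) /=; rewrite /interior/=.
  have : ball x0 e x by rewrite /ball/= distrC (lt_trans xK)// /K2 /K; lra.
  by move=> xb /(_ xb); apply: filterS => y; rewrite /ball/= distrC.
apply: filterS nx => y; rewrite distrC => /ec /= cy.
exact: cvg_lim cy.
Unshelve. all: by end_near. Qed.

Lemma analytic_derive1n U f n : real_analytic_on U f ->
  real_analytic_on U (f^`(n))%classic.
Proof.
by move=> fU; elim: n => // n /analytic_derive[_]; rewrite derive1nS.
Qed.

Lemma analytic_derivable U f n x : real_analytic_on U f -> U x ->
  derivable (f^`(n))%classic x 1.
Proof. by move=> /(@analytic_derive1n _ _ n)/analytic_derive[+ _]; apply. Qed.

(** Write x = x0 + (x - x0): the new series is [x0] times the old one plus the old one shifted by
    one index. Partial sums of length n + 1 therefore involve the old partial sums of lengths n + 1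
    and n. *)
Lemma analytic_mulX U f : real_analytic_on U f ->
  real_analytic_on U (fun x => x * f x).
Proof.
move=> fU x0 /fU[c cf].
exists (fun n => x0 * c n + (if n is k.+1 then c k else 0)).
apply: filterS cf => x cf; rewrite -cvg_shiftS /=.
have -> : (fun n => pseries (fun n => x0 * c n + (if n is k.+1 then c k else 0))
    (x - x0) n.+1) =
    (fun n => x0 * pseries c (x - x0) n.+1 + (x - x0) * pseries c (x - x0) n).
  apply/funext => n; rewrite /pseries /series/=.
  under eq_bigr do rewrite mulrDl -mulrA.
  rewrite big_split/= -mulr_sumr; congr (_ + _).
  rewrite big_nat_recl//= mul0r add0r mulr_sumr; apply: eq_bigr => i _.
  by rewrite exprS mulrCA.
have -> : x * f x = x0 * f x + (x - x0) * f x by ring.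
apply: cvgD; last exact: cvgMr.
apply: cvgMr; rewrite (cvg_shiftS (pseries c (x - x0))); exact: cf.
Qed.

Lemma analytic_cst U (r : R) : real_analytic_on U (cst r).
Proof.
move=> x0 _; exists (fun n => if n is 0%N then r else 0).
near=> x; rewrite -cvg_shiftS; apply: cvg_near_cst; near=> n.
rewrite /pseries/series/= big_nat_recl//= expr0 mulr1 big1 ?addr0// => i _.
by rewrite mul0r.
Unshelve. all: by end_near. Qed.

(** As [f] occurs with exponent 0 or 1, multiplication by x is the only product involved. *)
Lemma analytic_monomial U f i j : (j < 2)%N -> real_analytic_on U f ->
  real_analytic_on U (fun x => x ^+ i * f x ^+ j).
Proof.
move=> j2 fU; elim: i => [|i /analytic_mulX].
  under [fun _ => _]funext do rewrite mul1r.
  by case: j j2 => [|[|//]] _ //; apply: analytic_cst.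
by under [fun x => x * _]funext do rewrite mulrA -exprS.
Qed.

End analytic.

(** * Iterated derivatives and the iterated Rolle theorem *)

Section derivatives.
Context {R : realType}.
Implicit Types (U : set R) (g h : R -> R).

(** Rolle between consecutive nodes yields an increasing sequence of zeros of the derivative, one
    fewer than the nodes; induct on it. *)
Lemma iterated_Rolle h (x : nat -> R) n :
  (forall i, (i < n)%N -> x i < x i.+1) ->
  (forall i, (i <= n)%N -> h (x i) = 0) ->
  (forall j t, x 0%N <= t <= x n -> derivable (h^`(j))%classic t 1) ->
  exists2 t, x 0%N <= t <= x n & (h^`(n))%classic t = 0.
Proof.
elim: n h x => [|n IH] h x xlt hx hd; first by exists (x 0%N); [rewrite !lexx|exact: hx].
have xmono i j : (i <= j)%N -> (j <= n.+1)%N -> x i <= x j.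
  elim: j => [|j IHj]; first by rewrite leqn0 => /eqP->.
  rewrite leq_eqVlt => /predU1P[->//|]; rewrite ltnS => ij jn.
  exact: le_trans (IHj ij (ltnW jn)) (ltW (xlt _ jn)).
have /choice[y yP] i : exists y, (i <= n)%N ->
    x i < y < x i.+1 /\ (h^`())%classic y = 0.
  have [ni|ni] := leqP i n; last by exists 0.
  have hdi t : t \in `[x i, x i.+1] -> derivable h t 1.
    rewrite in_itv/= => /andP[t1 t2]; apply: (hd 0%N).
    have x0i : x 0%N <= x i by apply: xmono => //; exact: leqW.
    by rewrite (le_trans x0i t1) (le_trans t2)// xmono.
  have [|||| t tx [_ dt]] := @Rolle R h (x i) (x i.+1).
  - exact: xlt.
  - by move=> t /subset_itv_oo_cc; exact: hdi.
  - exact: derivable_within_continuous.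
  - by rewrite !hx// ltnW.
  - by exists t => _; rewrite derive1E dt; move: tx; rewrite in_itv.
have [||| t /andP[t1 t2] ht] := IH (h^`())%classic y.
- move=> i ni; have [/andP[_ yi] _] := yP _ (ltnW ni).
  by have [/andP[yi' _] _] := yP _ ni; exact: lt_trans yi yi'.
- by move=> i /yP[].
- move=> j t /andP[t1 t2]; rewrite -derive1Sn; apply: hd.
  have [/andP[+ _] _] := yP _ (leq0n n); have [/andP[_ +] _] := yP _ (leqnn n).
  lra.
exists t; last by rewrite derive1Sn.
have [/andP[+ _] _] := yP _ (leq0n n); have [/andP[_ +] _] := yP _ (leqnn n).
lra.
Qed.

(** Since [U] is open, the formula for order j holds on a neighbourhood of each point of [U], so it
    can be differentiated once more. *)
Lemma derive1n_sub_horner U g (P : {poly R}) : open U ->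
    (forall j x, U x -> derivable (g^`(j))%classic x 1) ->
  forall j x, U x -> (((fun t => g t - P.[t])^`(j))%classic x =
    (g^`(j))%classic x - (derivn j P).[x] /\
    derivable ((fun t => g t - P.[t])^`(j))%classic x 1).
Proof.
move=> oU gU; elim=> [|j IH] x Ux.
  by split=> //; apply: derivableB; [exact: (gU 0%N)|exact: derivable_horner].
have Unear : \forall y \near x, U y by exact: open_nbhs_nbhs.
have E y : U y -> ((fun t => g t - P.[t])^`(j.+1))%classic y =
    (g^`(j.+1))%classic y - (derivn j.+1 P).[y].
  move=> Uy; rewrite !derive1nS derive1E.
  rewrite (@near_eq_derive _ _ _ _ ((g^`(j))%classic \- horner (derivn j P))).
    rewrite deriveB; [|exact: gU|exact: derivable_horner].
    by rewrite -!derive1E -derivE derivnS.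
  have Uy' : \forall z \near y, U z by exact: open_nbhs_nbhs.
  by apply: filterS Uy' => z /IH[].
split; first exact: E.
apply: (@near_eq_derivable _ _ _ ((g^`(j.+1))%classic \- horner (derivn j.+1 P))).
  by apply: filterS Unear => y Uy; rewrite E.
by apply: derivableB; [exact: gU|exact: derivable_horner].
Qed.

End derivatives.

(** * Newton's divided differences *)

Section divided_differences.
Context {R : realFieldType}.
Implicit Types (x v w : nat -> R).

(* [newton_rem x v k i] is the k-fold divided difference of the values [v] at
   the nodes x_0, ..., x_(k-1), x_i; it is meaningful for k <= i. *)
Fixpoint newton_rem x v k i : R :=
  if k is l.+1 then (newton_rem x v l i - newton_rem x v l l) / (x i - x l)
  else v i.

Definition divdiff x v k := newton_rem x v k k.

Lemma newton_rem_expansion x v k i :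
  (forall l, (l < k)%N -> x i != x l) ->
  v i = \sum_(l < k) divdiff x v l * \prod_(m < l) (x i - x m)
    + newton_rem x v k i * \prod_(m < k) (x i - x m).
Proof.
elim: k => [|k IH] xi; first by rewrite !big_ord0 mulr1 add0r.
rewrite [LHS]IH; last by move=> l lk; rewrite xi// ltnW.
rewrite !big_ord_recr/= -addrA; congr (_ + _).
have : x i - x k != 0 by rewrite subr_eq0 xi.
by rewrite /divdiff => ?; field.
Qed.

(** The term l = i is the remainder, and every term with l > i contains the factor x_i - x_i. A
    range [n] independent of [i] turns the expansion into a matrix product. *)
Lemma newton_expansion x v n i : (i < n)%N ->
  (forall l, (l < i)%N -> x i != x l) ->
  v i = \sum_(l < n) \prod_(m < l) (x i - x m) * divdiff x v l.
Proof.
move=> ni xi; rewrite [LHS](newton_rem_expansion v xi).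
rewrite -(big_mkord xpredT (fun l => \prod_(m < l) (x i - x m) * divdiff x v l)).
rewrite (@big_cat_nat _ _ _ i.+1)//= [X in _ = _ + X]big_nat_cond.
rewrite [X in _ = _ + X]big1 ?addr0.
  rewrite big_mkord big_ord_recr/= mulrC; congr (_ + _).
  by apply: eq_bigr => l _; rewrite mulrC.
move=> l; rewrite andbT => /andP[il ln].
by rewrite (bigD1 (Ordinal il))//= subrr !mul0r.
Qed.

Lemma newton_remD x v w k i :
  newton_rem x (fun j => v j + w j) k i = newton_rem x v k i + newton_rem x w k i.
Proof. by elim: k i => //= k IH i; rewrite !IH -mulrDl; congr (_ / _); ring. Qed.

(** Each step subtracts two values and divides by a gap of at least [s], which costs a factor
    [2 / s]. *)
Lemma newton_rem_bound x v n (s E : R) : 0 < s ->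
  (forall i j, (i < n)%N -> (j < i)%N -> s <= `|x i - x j|) ->
  (forall i, (i < n)%N -> `|v i| <= E) ->
  forall k i, (k <= i)%N -> (i < n)%N -> `|newton_rem x v k i| <= (2 / s) ^+ k * E.
Proof.
move=> s0 xs vE; elim=> [|k IH] i ki ni; first by rewrite mul1r vE.
rewrite /= normrM normfV ler_pdivrMr ?(lt_le_trans s0) ?xs//.
have A := IH _ (ltnW ki) ni; have B := IH _ (leqnn k) (ltn_trans ki ni).
apply: (@le_trans _ _ (2 * ((2 / s) ^+ k * E))).
  by rewrite (le_trans (ler_normB _ _))//; lra.
have -> : 2 * ((2 / s) ^+ k * E) = (2 / s) ^+ k.+1 * E * s.
  by rewrite exprS; field; rewrite gt_eqF.
rewrite ler_wpM2l ?xs// mulr_ge0 ?exprn_ge0 ?divr_ge0 ?(ltW s0)//.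
exact: le_trans (normr_ge0 _) (vE _ ni).
Qed.

End divided_differences.

(** Subtract the Newton interpolation polynomial [P]: the difference vanishes at k + 1 nodes, so its
    k-th derivative has a zero, while the k-th derivative of [P] is the constant k! times its
    coefficient of degree k. *)
Lemma divdiff_mean_value {R : realType} (U : set R) (g : R -> R) (x : nat -> R) k :
  open U -> (forall j t, U t -> derivable (g^`(j))%classic t 1) ->
  (forall i j, (i < j <= k)%N -> x i < x j) ->
  (forall t, x 0%N <= t <= x k -> U t) ->
  exists2 t, x 0%N <= t <= x k &
    divdiff x (g \o x) k = (g^`(k))%classic t / k`!%:R.
Proof.
move=> oU gU xlt xU.
pose B l : {poly R} := \prod_(m < l) ('X - (x m)%:P).
pose P := \sum_(l < k.+1) divdiff x (g \o x) l *: B l.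
have Bm l : B l \is monic by rewrite rpred_prod// => m _; exact: monicXsubC.
have Bs l : size (B l) = l.+1 by rewrite size_prod_XsubC /index_enum -enumT size_enum_ord.
have Ps : (size P <= k.+1)%N.
  rewrite (leq_trans (size_sum _ _ _))//; apply/bigmax_leqP => l _.
  by rewrite (leq_trans (size_scale_leq _ _))// Bs.
have Pk : P`_k = divdiff x (g \o x) k.
  rewrite /P coef_sum big_ord_recr/= big1 => [|l _].
    rewrite add0r coefZ; have := monicP (Bm k); rewrite /lead_coef Bs /= => ->.
    by rewrite mulr1.
  by rewrite coefZ nth_default ?mulr0// Bs.
have Pd t : (derivn k P).[t] = divdiff x (g \o x) k * k`!%:R.
  have -> : derivn k P = (divdiff x (g \o x) k * k`!%:R)%:P.
    apply/polyP => -[|i]; rewrite coef_derivn coefC/=.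
      by rewrite addn0 Pk ffactnn mulr_natr.
    by rewrite nth_default ?mul0rn// (leq_trans Ps)// addnS ltnS leq_addr.
  by rewrite hornerC.
have Pi i : (i <= k)%N -> P.[x i] = g (x i).
  move=> ik; rewrite -[RHS]/((g \o x) i) (@newton_expansion _ x (g \o x) k.+1 i)//.
    rewrite horner_sum; apply: eq_bigr => l _; rewrite hornerZ mulrC /B horner_prod.
    by congr (_ * _); apply: eq_bigr => m _; rewrite hornerXsubC.
  by move=> l li; rewrite gt_eqF// xlt// li.
have H := derive1n_sub_horner P oU gU.
have [||| t tx] := @iterated_Rolle R (fun t => g t - P.[t]) x k.
- by move=> i ik; apply: xlt; rewrite ltnSn.
- by move=> i ik; rewrite Pi// subrr.
- by move=> j t /xU Ut; have [] := H j t Ut.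
have [-> _] := H k t (xU _ tx).
move=> /eqP; rewrite subr_eq0 Pd => /eqP gk; exists t => //.
by rewrite gk mulfK// pnatr_eq0 -lt0n fact_gt0.
Qed.

(** * Determinants: Vandermonde factor, perturbation, integrality *)

Section determinants.

Lemma det_scale_rows (R : comNzRingType) n (r : 'I_n -> R) (A : 'M[R]_n) :
  \det (\matrix_(i, j) (r i * A i j)) = \prod_i r i * \det A.
Proof.
have -> : \matrix_(i, j) (r i * A i j) = diag_mx (\row_i r i) *m A.
  by apply/matrixP => i j; rewrite mul_diag_mx !mxE.
rewrite det_mulmx det_diag; congr (_ * _).
by apply: eq_bigr => i _; rewrite mxE.
Qed.

(** The value matrix is the matrix of Newton basis polynomials at the nodes times the matrix of
    divided differences. The first factor is lower triangular, and its diagonal gives the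
    Vandermonde product. *)
Lemma det_divdiff (R : realFieldType) n (x : nat -> R) (v : 'I_n -> nat -> R) :
  (forall i j, (j < i < n)%N -> x i != x j) ->
  \det (\matrix_(i < n, j < n) v j i) =
  \prod_(i < n) \prod_(m < i) (x i - x m) *
  \det (\matrix_(k < n, j < n) divdiff x (v j) k).
Proof.
move=> xx.
pose L : 'M[R]_n := \matrix_(i, l) \prod_(m < l) (x i - x m).
have -> : \matrix_(i < n, j < n) v j i =
    L *m \matrix_(k < n, j < n) divdiff x (v j) k.
  apply/matrixP => i j; rewrite !mxE (@newton_expansion _ x (v j) n i)//.
    by apply: eq_bigr => l _; rewrite !mxE.
  by move=> l li; rewrite xx// li/=.
rewrite det_mulmx; congr (_ * _); rewrite det_trig.
  by apply: eq_bigr => i _; rewrite mxE.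
apply/is_trig_mxP => i j ij; rewrite mxE.
by rewrite (bigD1 (Ordinal ij))//= subrr mul0r.
Qed.

(** Replace the factors one at a time; as [1 <= B], each of the n differences is at most
    [B ^+ n * t]. *)
Lemma norm_prod_sub (R : realFieldType) n (u v : 'I_n -> R) (B t : R) : 1 <= B ->
  (forall i, `|u i| <= B) -> (forall i, `|v i| <= B) ->
  (forall i, `|u i - v i| <= t) ->
  `|\prod_i u i - \prod_i v i| <= n%:R * B ^+ n * t.
Proof.
move=> B1; have B0 : 0 <= B by rewrite (le_trans ler01).
elim: n u v => [|n IH] u v uB vB uv.
  by rewrite !big_ord0 subrr normr0 !mul0r.
have t0 : 0 <= t := le_trans (normr_ge0 _) (uv ord0).
rewrite !big_ord_recl.
set P := \prod_(i < n) _; set P' := \prod_(i < n) _.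
have -> : u ord0 * P - v ord0 * P' = u ord0 * (P - P') + (u ord0 - v ord0) * P'.
  by ring.
have h1 : `|P - P'| <= n%:R * B ^+ n * t by apply: IH => i.
have h2 : `|P'| <= B ^+ n.
  rewrite normr_prod -[in leRHS](card_ord n) -prodr_const ler_prod// => i _.
  by rewrite normr_ge0 vB.
rewrite (le_trans (ler_normD _ _))// !normrM.
have h3 : `|u ord0| * `|P - P'| <= B * (n%:R * B ^+ n * t) by rewrite ler_pM.
have h4 : `|u ord0 - v ord0| * `|P'| <= t * B ^+ n by rewrite ler_pM.
have h5 : t * B ^+ n <= t * B ^+ n.+1.
  by rewrite ler_wpM2l// ler_weXn2l.
rewrite -nat1r exprS; move: h5; rewrite exprS; nra.
Qed.

Lemma norm_det_sub (R : realFieldType) n (M M' : 'M[R]_n) (B t : R) : 1 <= B ->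
  (forall i j, `|M i j| <= B) -> (forall i j, `|M' i j| <= B) ->
  (forall i j, `|M i j - M' i j| <= t) ->
  `|\det M - \det M'| <= n`!%:R * (n%:R * B ^+ n * t).
Proof.
move=> B1 MB MB' MM'; rewrite /determinant -sumrB.
rewrite (le_trans (ler_norm_sum _ _ _))//.
rewrite -card_Sn mulr_natl -sumr_const ler_sum// => s _.
by rewrite -mulrBr normrM normrX normrN1 expr1n mul1r norm_prod_sub.
Qed.

(* Row k becomes integral after multiplication by q_k^d b_k. *)
Lemma det_rational_ge (R : realFieldType) d (p a : nat -> int) (q b : nat -> nat) :
  let n := (2 * d.+1)%N in
  let D := \det (\matrix_(k < n, j < n)
    (((p k)%:~R / (q k)%:R : R) ^+ (j %/ 2) * ((a k)%:~R / (b k)%:R) ^+ (j %% 2))) in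
  (forall k, (k < n)%N -> (0 < q k)%N && (0 < b k)%N) -> D != 0 ->
  1 <= \prod_(k < n) ((q k)%:R ^+ d * (b k)%:R) * `|D|.
Proof.
move=> n D qb D0.
pose r (k : 'I_n) : R := (q k)%:R ^+ d * (b k)%:R.
have r0 k : 0 < r k.
  by have /andP[? ?] := qb _ (ltn_ord k); rewrite mulr_gt0 ?exprn_gt0 ?ltr0n.
(* A monomial of bidegree (i, j) uses only [q ^ i] and [b ^ j] of the row factor; the leftover
   powers d - i and 1 - j go to the numerator. *)
pose Z : 'M[int]_n := \matrix_(k, j)
  (p k ^+ (j %/ 2) * (q k)%:Z ^+ (d - j %/ 2) *
   (a k ^+ (j %% 2) * (b k)%:Z ^+ (1 - j %% 2))).
have E : \prod_(k < n) r k * D = (\det Z)%:~R.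
  rewrite -det_map_mx -det_scale_rows; congr (\det _).
  apply/matrixP => k j; rewrite !mxE.
  have /andP[q0 b0] := qb _ (ltn_ord k).
  have qn : (q k)%:R != 0 :> R by rewrite pnatr_eq0 -lt0n.
  have bn : (b k)%:R != 0 :> R by rewrite pnatr_eq0 -lt0n.
  have jd : (j %/ 2 <= d)%N.
    by rewrite -ltnS ltn_divLR// mulnC ltn_ord.
  rewrite !rmorphM !rmorphXn/= !expr_div_n.
  rewrite /r -[in LHS](subnK jd) exprD.
  have : (j %% 2 < 2)%N by rewrite ltn_mod.
  case: (j %% 2)%N => [|[|//]] _; rewrite /= ?subn0 ?subnn ?expr0 ?expr1.
    by field; rewrite expf_neq0.
  by field; rewrite bn expf_neq0.
have -> : \prod_(k < n) ((q k)%:R ^+ d * (b k)%:R) * `|D| = `|\prod_(k < n) r k * D|.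
  rewrite normrM [X in _ = X * _]ger0_norm//.
  by apply: prodr_ge0 => k _; exact: ltW.
rewrite E -intr_norm ler1z -gtz0_ge1 normr_gt0 -(intr_eq0 R) -E mulf_neq0//.
by apply/prodf_neq0 => k _; rewrite gt_eqF.
Qed.

End determinants.

(** * Uniform bounds on a compact interval *)

Section smooth_bounds.
Context {R : realType}.
Implicit Types (U : set R) (g : R -> R).

Lemma bounded_on_segment (c e : R) g : {within `[c, e], continuous g} ->
  exists2 B : R, 0 <= B & forall t, t \in `[c, e] -> `|g t| <= B.
Proof.
move=> gc; have [ce|ec] := leP c e; last first.
  by exists 0 => // t; rewrite in_itv/= => /andP[ct /(le_trans ct)]; rewrite leNgt ec.
have [u _ uP] := EVT_max ce gc; have [v _ vP] := EVT_min ce gc.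
exists (`|g u| + `|g v|) => [|t tce]; first by rewrite addr_ge0.
have := uP t tce; have := vP t tce; have := ler_norm (g u).
have := ler_norm (- g v); rewrite normrN => ? ? ? ?.
rewrite ler_norml; have := normr_ge0 (g u); have := normr_ge0 (g v); lra.
Qed.

Lemma lipschitz_of_derive (c e B : R) g :
  (forall t, t \in `[c, e] -> derivable g t 1) ->
  (forall t, t \in `[c, e] -> `|(g^`())%classic t| <= B) ->
  forall t u, t \in `[c, e] -> u \in `[c, e] -> `|g t - g u| <= B * `|t - u|.
Proof.
move=> gd gB t u.
wlog ut : t u / u <= t => [H tce uce|].
  have [ut|/ltW tu] := leP u t; first exact: H.
  by rewrite distrC [X in _ * X]distrC; exact: H.
move=> tce uce.
have sub s : s \in `[u, t] -> s \in `[c, e].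
  by move: tce uce; rewrite !in_itv/= => /andP[? ?] /andP[? ?] /andP[? ?]; lra.
have [s|| s sut ->] := @MVT_segment R g (g^`())%classic u t ut.
- move=> /subset_itv_oo_cc/sub/gd sd; rewrite derive1E; exact: derivableP.
- by apply: derivable_within_continuous => s /sub; exact: gd.
by rewrite normrM ler_wpM2r// gB// sub.
Qed.

Lemma lipschitz_within_continuous (c e B : R) g : 0 <= B ->
  (forall t u, t \in `[c, e] -> u \in `[c, e] -> `|g t - g u| <= B * `|t - u|) ->
  {within `[c, e], continuous g}.
Proof.
move=> B0 gB; apply/subspace_continuousP => x /= xce.
apply/cvgrPdist_le => eps eps0 /=.
(* [B] may be zero, so the radius divides by [B + 1]. *)
have B1 : 0 < B + 1 by rewrite ltr_wpDl.
apply/nbhs_ballP; exists (eps / (B + 1)) => [|y /=]; first by rewrite /= divr_gt0.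
rewrite /ball/= ltr_pdivlMr// => xy yce.
rewrite (le_trans (gB x y xce yce))//.
have := normr_ge0 (x - y); nra.
Qed.

(** The orders go up to [n], one beyond the last Wronskian row, so that each entry of the Wronskian
    matrix also gets a Lipschitz bound. *)
Lemma uniform_derivative_bound U (c e : R) n (phi : 'I_n -> R -> R) :
  `[c, e] `<=` U -> (forall j, real_analytic_on U (phi j)) ->
  exists2 B : R, 1 <= B & forall (j : 'I_n) k t, (k <= n)%N -> t \in `[c, e] ->
    `|((phi j)^`(k))%classic t| <= B.
Proof.
move=> ceU phiU.
have /choice[B BP] (jk : 'I_n * nat) : exists B, 0 <= B /\ forall t,
    t \in `[c, e] -> `|((phi jk.1)^`(jk.2))%classic t| <= B.
  have [|B ? ?] := @bounded_on_segment c e ((phi jk.1)^`(jk.2))%classic.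
    apply: derivable_within_continuous => t /= tce.
    exact: analytic_derivable (phiU _) (ceU _ tce).
  by exists B.
have B0 j : 0 <= B j by have [] := BP j.
exists (1 + \sum_(k < n.+1) \sum_(j < n) B (j, val k)).
  by rewrite lerDl !sumr_ge0// => k _; rewrite sumr_ge0.
move=> j k t kn tce; rewrite (le_trans ((BP (j, k)).2 t tce))//.
rewrite (bigD1 (Ordinal (kn : (k < n.+1)%N)))//= (bigD1 j)//=.
rewrite addrCA -addrA lerDl !addr_ge0// ?sumr_ge0// => i _; rewrite ?sumr_ge0//.
Qed.

End smooth_bounds.

(** * Determinants close to a nonvanishing Wronskian *)

Section wronskian_estimate.
Context {R : realType}.

(** Row k is divided by k! because a k-th divided difference equals a k-th derivative over k!. *)
Lemma wronskian_scaled n (phi : 'I_n -> R -> R) t :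
  \det (\matrix_(k < n, j < n) (k`!%:R^-1 * ((phi j)^`(k))%classic t)) =
  \prod_(k < n) (k`!%:R^-1) * wronskian phi t.
Proof.
rewrite /wronskian -det_scale_rows; congr (\det _).
by apply/matrixP => k j; rewrite !mxE.
Qed.

(* Up to a factor close to W / prod_k k!, the determinant of the perturbed values
   is the Vandermonde determinant of the nodes. *)
Lemma det_near_values (U : set R) (c e : R) n (phi : 'I_n -> R -> R) :
  open U -> `[c, e] `<=` U -> c < e -> (0 < n)%N ->
  (forall j, real_analytic_on U (phi j)) ->
  (forall t, t \in `[c, e] -> wronskian phi t != 0) ->
  exists del eta K : R, [/\ 0 < del, 0 < eta, 0 < K &
    forall (x : nat -> R) (v : 'I_n -> nat -> R) (s E : R),
      (forall i j, (i < j < n)%N -> x i < x j) ->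
      (forall i, (i < n)%N -> x i \in `[c, e]) ->
      x n.-1 - x 0%N <= del ->
      0 < s <= 2 -> (forall i j, (j < i < n)%N -> s <= `|x i - x j|) ->
      (forall j i, (i < n)%N -> `|v j i - phi j (x i)| <= E) ->
      (2 / s) ^+ n.-1 * E <= eta ->
      let D := \det (\matrix_(i < n, j < n) v j i) in
      D != 0 /\ `|D| <= K * \prod_(i < n) \prod_(m < i) `|x i - x m|].
Proof.
move=> oU ceU ce n0 phiU W0.
have [B B1 BP] := uniform_derivative_bound ceU phiU.
have B0 : 0 < B by exact: lt_le_trans ltr01 B1.
(* [M0 t] is the limit of the divided difference matrix as all nodes tend to [t]. *)
pose M0 t : 'M[R]_n := \matrix_(k < n, j < n) (k`!%:R^-1 * ((phi j)^`(k))%classic t).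
have kf k : 0 <= (k`!%:R^-1 : R) <= 1.
  by rewrite invr_ge0 ler0n/= invf_le1 ?ltr0n ?fact_gt0// ler1n fact_gt0.
have kfM k (z Z : R) : `|z| <= Z -> `|k`!%:R^-1 * z| <= Z.
  move=> zZ; rewrite normrM; have /andP[k0 k1] := kf k.
  by rewrite (ger0_norm k0) (le_trans _ zZ)// ler_piMl.
have M0B t k j : t \in `[c, e] -> `|M0 t k j| <= B.
  by move=> tce; rewrite mxE kfM// BP// ltnW.
have M0L t u k j : t \in `[c, e] -> u \in `[c, e] ->
    `|M0 t k j - M0 u k j| <= B * `|t - u|.
  move=> tce uce; rewrite !mxE -mulrBr kfM//.
  apply: (@lipschitz_of_derive _ c e) tce uce => [s sce|s sce].
    exact: analytic_derivable (phiU _) (ceU _ sce).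
  by rewrite -derive1nS BP.
(* A Lipschitz constant of the determinant on matrices with entries at most [B + 1]; the extra 1
   leaves room for the perturbed matrix. *)
pose Lc := n`!%:R * (n%:R * (B + 1) ^+ n) : R.
have Lc0 : 0 < Lc.
  by rewrite !mulr_gt0 ?exprn_gt0 ?ltr0n ?fact_gt0// addr_gt0.
have detL (P Q : 'M[R]_n) (z : R) : (forall k j, `|P k j| <= B + 1) ->
    (forall k j, `|Q k j| <= B + 1) -> (forall k j, `|P k j - Q k j| <= z) ->
    `|\det P - \det Q| <= Lc * z.
  move=> PB QB PQ; rewrite /Lc -!mulrA [(B + 1) ^+ n * z]mulrC [z * _]mulrC mulrA.
  rewrite -[X in _ <= X]mulrA [n%:R * (_ * _)]mulrA.
  by apply: norm_det_sub => //; rewrite lerDr ltW.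
clearbody Lc.
(* By compactness, the nonvanishing of the Wronskian becomes a uniform lower bound. *)
have [w w0 wP] : exists2 w : R, 0 < w & forall t, t \in `[c, e] -> w <= `|\det (M0 t)|.
  have cM : {within `[c, e], continuous (fun t => `|\det (M0 t)|)}.
    apply: (@lipschitz_within_continuous _ _ _ (Lc * B)).
      by rewrite mulr_ge0// ltW.
    move=> t u tce uce; rewrite (le_trans (ler_dist_dist _ _))//.
    rewrite -mulrA; apply: detL => k j; last exact: M0L.
    - by rewrite (le_trans (M0B _ _ _ tce))// lerDl.
    - by rewrite (le_trans (M0B _ _ _ uce))// lerDl.
  have [u uce uP] := EVT_min (ltW ce) cM; exists `|\det (M0 u)| => //.
  rewrite normr_gt0 wronskian_scaled mulf_neq0 ?W0//.
  by apply/prodf_neq0 => k _; rewrite invr_eq0 pnatr_eq0 -lt0n fact_gt0.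
(* The entrywise tolerance: at most 1 to keep entries below [B + 1], and small enough to move the
   determinant by at most [w / 2]. *)
pose th := Num.min 1 (w / (2 * Lc)).
have th0 : 0 < th.
  by rewrite /th lt_min ltr01/= divr_gt0 ?mulr_gt0.
have th1 : th <= 1 by rewrite /th ge_min lexx.
have thL : Lc * th <= w / 2.
  have : th <= w / (2 * Lc) by rewrite /th ge_min lexx orbT.
  by rewrite ler_pdivlMr ?mulr_gt0//; lra.
(* Half of [th] is allotted to the spread of the nodes and half to the perturbation of the values.
   The last constant bounds the determinant of divided differences. *)
exists (th / (2 * B)), (th / 2), (Lc * (B + 1)); split.
- by rewrite divr_gt0 ?mulr_gt0.
- by rewrite divr_gt0.
- by rewrite mulr_gt0 ?addr_gt0.
move=> x v s E xlt xce xdel /andP[s0 s2] xs vE seta D.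
have xx i j : (j < i < n)%N -> x i != x j by move=> ?; rewrite gt_eqF ?xlt.
have E0 : 0 <= E by rewrite (le_trans (normr_ge0 _) (vE (Ordinal n0) 0%N n0)).
pose DD : 'M[R]_n := \matrix_(k < n, j < n) divdiff x (v j) k.
have x0k k : (k < n)%N -> x 0%N <= x k.
  by case: k => // k kn; rewrite ltW// xlt.
have xkn k : (k < n)%N -> x k <= x n.-1.
  move=> kn; have [->//|kn1] := eqVneq k n.-1.
  have kn2 : (k < n.-1)%N by rewrite ltn_neqAle kn1/= -ltnS prednK.
  by rewrite ltW// xlt// kn2/= prednK.
have x0 := xce _ n0.
(* By linearity, split the divided difference into that of [phi j], handled by the mean value form,
   and that of the error, handled by the crude bound. *)
have DDM k j : `|DD k j - M0 (x 0%N) k j| <= th.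
  have kn := ltn_ord k.
  have -> : DD k j = divdiff x (phi j \o x) k +
      newton_rem x (fun i => v j i - phi j (x i)) k k.
    rewrite mxE /divdiff -newton_remD; congr (newton_rem x _ k k).
    by apply/funext => i /=; rewrite addrC subrK.
  have h1 : `|newton_rem x (fun i => v j i - phi j (x i)) k k| <= th / 2.
    apply: le_trans seta.
    have := @newton_rem_bound _ x (fun i => v j i - phi j (x i)) n s E s0
      (fun i l ni li => xs i l (etrans (congr1 (andb^~ _) li) ni)) (vE j) k k (leqnn k) kn.
    move=> /le_trans; apply; rewrite ler_wpM2r//.
    (* As [s <= 2], the base [2 / s] is at least 1, so the exponent [k] may be raised to [n.-1]. *)
    by rewrite ler_weXn2l ?ler_pdivlMr ?mul1r// -ltnS prednK.
  have xltk i l : (i < l <= k)%N -> x i < x l.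
    by move=> /andP[il lk]; rewrite xlt// il (leq_ltn_trans lk kn).
  have xU t : x 0%N <= t <= x k -> U t.
    move=> /andP[t0 t1]; apply: ceU => /=; move: (xce _ kn) x0; rewrite !in_itv/=.
    by move=> /andP[? ?] /andP[? ?]; lra.
  have [t /andP[tx0 tx1] ->] := divdiff_mean_value oU
    (fun i t Ut => @analytic_derivable _ _ _ i _ (phiU j) Ut) xltk xU.
  have tce : t \in `[c, e].
    by move: (xce _ kn) x0; rewrite !in_itv/= => /andP[? ?] /andP[? ?]; lra.
  have -> : ((phi j)^`(k))%classic t / k`!%:R = M0 t k j by rewrite mxE mulrC.
  have h2 := M0L t (x 0%N) k j tce x0.
  have h3 : B * `|t - x 0%N| <= th / 2.
    rewrite ger0_norm ?subr_ge0//.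
    have : t - x 0%N <= th / (2 * B).
      by rewrite (le_trans _ xdel)// lerB// (le_trans tx1)// xkn.
    by rewrite ler_pdivlMr ?mulr_gt0//; lra.
  rewrite addrAC (le_trans (ler_normD _ _))//; lra.
have M0B1 k j : `|M0 (x 0%N) k j| <= B + 1.
  by rewrite (le_trans (M0B _ _ _ x0))// lerDl.
have DDB k j : `|DD k j| <= B + 1.
  rewrite -(subrK (M0 (x 0%N) k j) (DD k j)) (le_trans (ler_normD _ _))//.
  by rewrite addrC lerD ?M0B// (le_trans (DDM k j)).
have DE : D = \prod_(i < n) \prod_(m < i) (x i - x m) * \det DD.
  exact: det_divdiff.
have V0 : \prod_(i < n) \prod_(m < i) (x i - x m) != 0.
  apply/prodf_neq0 => i _; apply/prodf_neq0 => m _.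
  by rewrite subr_eq0 xx// ltn_ord/=.
have dDD : `|\det DD - \det (M0 (x 0%N))| <= w / 2.
  by apply: le_trans thL; exact: detL.
have DD0 : \det DD != 0.
  rewrite -normr_gt0.
  have := ler_distD 0 (\det (M0 (x 0%N))) (\det DD); rewrite subr0 sub0r normrN.
  have := wP _ x0; have := ler_normB (\det DD) (\det DD - \det (M0 (x 0%N))).
  rewrite opprB addrC subrK; lra.
split; first by rewrite DE mulf_neq0.
rewrite DE normrM mulrC normr_prod.
under [X in _ * X <= _]eq_bigr do rewrite normr_prod.
rewrite ler_wpM2r ?prodr_ge0// => [i _|]; first by rewrite prodr_ge0.
(* The upper bound compares [DD] with the zero matrix; the size must be positive since the empty
   determinant is 1. *)
have det_0 l : (0 < l)%N -> \det (0 : 'M[R]_l) = 0 by case: l => // l _; exact: det0.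
have := detL DD 0 (B + 1) DDB; rewrite det_0// subr0; apply => k j.
  by rewrite mxE normr0 addr_ge0// ltW.
by rewrite [X in _ - X]mxE subr0.
Qed.

End wronskian_estimate.

(** * Counting points by covering lists *)

Section counting.
Context {R : realType}.
Implicit Types (S : set R) (r : R).

(** The list may repeat or overshoot, so unions are concatenations and finiteness comes along with
    the bound. *)
Definition at_most S r := exists2 l : seq R, forall x, S x -> x \in l & (size l)%:R <= r.

Lemma at_most_sub S S' r r' : S `<=` S' -> r' <= r -> at_most S' r' -> at_most S r.
Proof. by move=> SS rr [l lS lr]; exists l => [x /SS/lS//|]; exact: le_trans rr. Qed.

Lemma at_mostU S S' r r' : at_most S r -> at_most S' r' -> at_most (S `|` S') (r + r').
Proof.
move=> [l lS lr] [l' lS' lr']; exists (l ++ l'); last by rewrite size_cat natrD lerD.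
by move=> x [/lS|/lS']; rewrite mem_cat => ->//; rewrite orbT.
Qed.

Lemma at_most_bigcup (I : eqType) (l : seq I) (F : I -> set R) (r : I -> R) :
  (forall i, i \in l -> at_most (F i) (r i)) ->
  at_most [set x | exists2 i, i \in l & F i x] (\sum_(i <- l) r i).
Proof.
elim: l => [|i l IH] Fr; first by rewrite big_nil; exists [::] => // x [].
rewrite big_cons.
apply: at_most_sub (lexx _) (at_mostU (Fr i _) (IH _)) => [x [j]||j jl].
- by rewrite inE => /predU1P[->|jl] Fx; [left|right; exists j].
- exact: mem_head.
- by apply: Fr; rewrite inE jl orbT.
Qed.

Lemma at_most_card S r : at_most S r -> finite_set S /\ #|` fset_set S|%:R <= r.
Proof.
move=> [l lS lr].
have fS : finite_set S.
  by apply: sub_finite_set (finite_seq l) => x /lS.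
split=> //; apply: le_trans lr; rewrite ler_nat.
apply: (@leq_trans #|` [fset x in l]%fset|).
  apply: fsubset_leq_card; apply/fsubsetP => x; rewrite in_fset_set// inE => /lS.
  by rewrite !inE.
by rewrite card_fseq size_undup.
Qed.

Lemma at_most_inj S (g : R -> nat) n :
  (forall x, S x -> (g x < n)%N) -> {in S &, injective g} -> at_most S n%:R.
Proof.
move=> gn ginj.
have /choice[h hP] i : exists y, forall x, S x -> g x = i -> x = y.
  have [[y Sy <-]|N] := pselect (exists2 y, S y & g y = i).
    by exists y => x Sx gxy; apply: ginj => //; rewrite inE.
  by exists 0 => x Sx gx; exfalso; apply: N; exists x.
exists (map h (iota 0 n)); last by rewrite size_map size_iota.
move=> x Sx; apply/mapP; exists (g x); last exact: hP.
by rewrite mem_iota/= add0n gn.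
Qed.

(** Cut the interval into half-open cells of length [s]: two points of one cell would be closer than
    [s], so the cell index is injective on [S]. *)
Lemma at_most_separated S (u len s : R) : 0 < s -> 0 <= len ->
  (forall x, S x -> u <= x <= u + len) ->
  (forall x y, S x -> S y -> x != y -> s <= `|x - y|) ->
  at_most S (len / s + 1).
Proof.
move=> s0 l0 Su Ss.
have ls0 : 0 <= len / s by rewrite divr_ge0// ltW.
apply: (@at_most_sub S S _ (Num.truncn (len / s)).+1%:R) => //.
  by rewrite -natr1 lerD2r truncn_le.
have xs0 x : S x -> 0 <= (x - u) / s.
  by move=> /Su/andP[ux _]; rewrite divr_ge0 ?subr_ge0// ltW.
apply: (@at_most_inj _ (fun x => Num.truncn ((x - u) / s))) => [x Sx|x y].
  by have /andP[_ xu] := Su x Sx; rewrite ltnS le_truncn// ler_pM2r ?invr_gt0//; lra.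
rewrite !inE => Sx Sy gxy; apply: contrapT => /eqP xy; have := Ss x y Sx Sy xy.
apply/negP; rewrite -ltNge.
have /andP[x1 x2] := truncn_itv (xs0 _ Sx); have /andP[y1 y2] := truncn_itv (xs0 _ Sy).
rewrite -gxy in y1 y2; move: x1 x2 y1 y2; rewrite -natr1.
rewrite !ler_pdivlMr// !ltr_pdivrMr// => x1 x2 y1 y2.
rewrite ltr_norml; lra.
Qed.

(** If no list of length at most [n] covered [S], a list of distinct points of [S] could be grown to
    length n + 1. *)
Lemma at_most_uniq S n :
  (forall l : seq R, uniq l -> (forall x, x \in l -> S x) -> (size l <= n)%N) ->
  at_most S n%:R.
Proof.
move=> H; apply: contrapT => N.
have : forall k, (k <= n.+1)%N ->
    exists l : seq R, [/\ uniq l, forall x, x \in l -> S x & size l = k].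
  elim=> [_|k IH kn]; first by exists [::].
  have [l [ul lS lk]] := IH (ltnW kn).
  have [x [Sx xl]] : exists x, S x /\ x \notin l.
    apply: contrapT => N'; apply: N; exists l; last by rewrite lk ler_nat -ltnS.
    by move=> x Sx; apply: contrapT => /negP xl; apply: N'; exists x.
  exists (x :: l); split=> /=; [by rewrite xl|move=> y|by rewrite lk].
  by rewrite inE => /predU1P[->//|/lS].
by move=> /(_ _ (leqnn _))[l [ul lS lk]]; have := H l ul lS; rewrite lk ltnn.
Qed.

Lemma at_most_windows S (c len l r : R) : 0 < l -> 0 <= len -> 0 <= r ->
  (forall x, S x -> c <= x <= c + len) ->
  (forall u, at_most [set x | S x /\ u <= x <= u + l] r) ->
  at_most S ((len / l + 1) * r).
Proof.
move=> l0 len0 r0 Sc Sl.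
have ls0 : 0 <= len / l by rewrite divr_ge0// ltW.
pose n := Num.truncn (len / l).
pose F i := [set x | S x /\ c + i%:R * l <= x <= c + i%:R * l + l].
have := @at_most_bigcup _ (iota 0 n.+1) F (fun=> r) (fun i _ => Sl _).
rewrite big_const_seq count_predT size_iota iter_addr_0 -mulr_natl => H.
apply: at_most_sub H => [x Sx|].
  have /andP[x1 x2] := Sc x Sx.
  have xc0 : 0 <= (x - c) / l by rewrite divr_ge0 ?subr_ge0// ltW.
  exists (Num.truncn ((x - c) / l)).
    by rewrite mem_iota add0n /= ltnS le_truncn// ler_pM2r ?invr_gt0//; lra.
  split=> //; have /andP[] := truncn_itv xc0; rewrite -natr1.
  rewrite !ler_pdivlMr// !ltr_pdivrMr//; lra.
by rewrite ler_wpM2r// -natr1 lerD2r truncn_le.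
Qed.

End counting.

(** The difference is a nonzero integer divided by q q', and q q' < 4 Q^2. *)
Lemma rational_separation (R : realFieldType) (Q q q' : nat) (p p' : int) :
  let x := p%:~R / q%:R : R in let x' := p'%:~R / q'%:R : R in
  (0 < q < 2 * Q)%N -> (0 < q' < 2 * Q)%N -> x != x' ->
  (4 * Q%:R ^+ 2)^-1 <= `|x - x'|.
Proof.
move=> x x' /andP[q0 qQ] /andP[q0' qQ'] xx.
have qn : 0 < q%:R :> R by rewrite ltr0n.
have qn' : 0 < q'%:R :> R by rewrite ltr0n.
have Qn : 0 < Q%:R :> R by rewrite ltr0n; lia.
have E : x - x' = (p * q' - p' * q)%:~R / (q%:R * q'%:R).
  by rewrite /x /x' rmorphB/= !rmorphM/=; field; rewrite !gt_eqF.
have Z : 1 <= `|(p * q' - p' * q)%:~R : R|.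
  rewrite -intr_norm ler1z -gtz0_ge1 normr_gt0 -(intr_eq0 R).
  by apply: contra_neq xx => Z; apply/eqP; rewrite -subr_eq0 E Z mul0r.
rewrite E normrM normfV (ger0_norm (ltW (mulr_gt0 qn qn'))).
rewrite ler_pdivlMr ?mulr_gt0// (le_trans _ Z)// mulrC ler_pdivrMr ?mulr_gt0 ?exprn_gt0//.
rewrite mul1r -[4%:R]/((2 * 2)%:R) -natrX -!natrM ler_nat expnS expn1; nia.
Qed.

(** With n = 2 (d + 1), up to n - 1 divided differences at spacing of order Q^(-2) lose Q^(2 (n -
    1)). The error Q^(-38 d) pays for this and leaves one power of Q to absorb constants. *)
Lemma exponent_gap d : (0 < d)%N -> ((2 * (2 * d.+1).-1).+1 <= 38 * d)%N.
Proof. lia. Qed.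

(** * Large denominators: the determinant method *)

Section large_denominators.
Context {R : realType}.

Lemma powR_17_10 (Q : nat) : (Q%:R `^ (17%:R / 10%:R) : R) ^+ 10 = Q%:R ^+ 17.
Proof.
rewrite -powR_mulrn ?powR_ge0// -powRrM divfK ?pnatr_eq0// powR_mulrn//.
Qed.

Lemma le_powR_17_10 (Q : nat) (z : R) : 0 <= z -> z ^+ 10 <= Q%:R ^+ 17 ->
  z <= Q%:R `^ (17%:R / 10%:R).
Proof.
by move=> z0; rewrite -powR_17_10 ler_pXn2r// nnegrE powR_ge0.
Qed.

(** This is the number of factors in the Vandermonde product. *)
Lemma sum_ord_double d : (\sum_(i < 2 * d.+1) i = d.+1 * (2 * d).+1)%N.
Proof.
rewrite -(big_mkord xpredT id) triangular_sum bin2.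
have -> : ((2 * d.+1).-1 = (2 * d).+1)%N by rewrite mulnS.
by rewrite -mulnA mul2n doubleK.
Qed.

Lemma prod_dist_le n (x : nat -> R) (l : R) :
  (forall i j, (j < i < n)%N -> `|x i - x j| <= l) ->
  \prod_(i < n) \prod_(m < i) `|x i - x m| <= l ^+ (\sum_(i < n) i).
Proof.
move=> xl; rewrite expr_sum ler_prod// => i _.
rewrite prodr_ge0//= -[in leRHS](card_ord i) -prodr_const ler_prod// => m _.
by rewrite normr_ge0 xl// ltn_ord/=.
Qed.

(* Raising to the tenth power makes all exponents of Q natural numbers. *)
Lemma height_bound d (Q : nat) (q b : nat -> nat) (K l : R) :
  let n := (2 * d.+1)%N in
  (0 < Q)%N -> 0 <= K -> 0 <= l -> l ^+ 10 * Q%:R ^+ 17 <= 1 ->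
  (forall k, (k < n)%N -> (q k <= 2 * Q)%N) ->
  (forall k, (k < n)%N -> (b k ^ 5 <= Q ^ (2 * d + 2))%N) ->
  1 <= \prod_(k < n) ((q k)%:R ^+ d * (b k)%:R) * (K * l ^+ (\sum_(i < n) i)) ->
  Q%:R <= (K * (2 ^ d)%:R ^+ n) ^+ 10.
Proof.
move=> n Q0 K0 l0 lQ qQ bQ H.
have Q0' : 0 < Q%:R :> R by rewrite ltr0n.
have Q1 : 1 <= Q%:R :> R by rewrite ler1n.
pose P : R := \prod_(k < n) ((q k)%:R ^+ d * (b k)%:R).
have P0 : 0 <= P by apply: prodr_ge0 => k _; rewrite mulr_ge0 ?exprn_ge0.
have P10 : P ^+ 10 <= ((2 ^ d)%:R ^+ n) ^+ 10 * Q%:R ^+ ((14 * d + 4) * n).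
  rewrite -exprM [(n * 10)%N]mulnC exprM [in leRHS]exprM -exprMn -prodrXl.
  rewrite -[X in _ <= _ ^+ X](card_ord n) -prodr_const ler_prod// => k _.
  rewrite exprn_ge0 ?mulr_ge0 ?exprn_ge0//= exprMn.
  have -> : (2 ^ d)%:R ^+ 10 * Q%:R ^+ (14 * d + 4) =
      ((2 ^ d)%:R * Q%:R ^+ d) ^+ 10 * (Q%:R ^+ (2 * d + 2)) ^+ 2 :> R.
    have -> : (14 * d + 4 = d * 10 + (2 * d + 2) * 2)%N by lia.
    by rewrite exprD (exprM _ d 10) (exprM _ _ 2) exprMn mulrA.
  rewrite ler_pM ?exprn_ge0//.
    rewrite lerXn2r ?nnegrE ?mulr_ge0 ?exprn_ge0// natrX -exprMn.
    by rewrite lerXn2r ?nnegrE// -natrM ler_nat qQ.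
  rewrite (exprM _ 5 2) lerXn2r ?nnegrE ?exprn_ge0//.
  by rewrite -!natrX ler_nat bQ.
have l10 : (l ^+ (\sum_(i < n) i)) ^+ 10 * Q%:R ^+ (17 * (\sum_(i < n) i)) <= 1.
  by rewrite -exprM mulnC !exprM -exprMn exprn_ile1 ?mulr_ge0 ?exprn_ge0.
have H10 : 1 <= P ^+ 10 * (K ^+ 10 * (l ^+ (\sum_(i < n) i)) ^+ 10).
  by rewrite -!exprMn exprn_ege1.
set Z := (l ^+ _) ^+ 10 in l10 H10.
have Z0 : 0 <= Z by rewrite !exprn_ge0.
rewrite exprMn; set T := (_ ^+ n) ^+ 10 in P10 *.
have T0 : 0 <= T by rewrite !exprn_ge0.
rewrite sum_ord_double in l10.
(* The balance of exponents of Q after tenth powers: the Vandermonde product gains the left side,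
   the denominators lose [14 * d + 4] per row (10 d from [q ^ d], 4 d + 4 from [b]), and the
   positive surplus bounds [Q]. *)
have ed : (17 * (d.+1 * (2 * d).+1) = (14 * d + 4) * n + (6 * d + 9) * d.+1)%N.
  by rewrite /n; ring.
rewrite ed exprD in l10; set Y := Q%:R ^+ _ in P10 l10.
have Y0 : 0 <= Y by rewrite exprn_ge0.
have K10 : 0 <= K ^+ 10 by rewrite exprn_ge0.
set k10 := K ^+ 10 in K10 H10 *.
have h : Q%:R <= Q%:R ^+ ((6 * d + 9) * d.+1) :> R.
  by rewrite -[leLHS]expr1 ler_weXn2l// muln_gt0 addn_gt0 orbT.
apply: (le_trans h); set y := Q%:R ^+ _ in l10 *.
have y0 : 0 <= y by rewrite exprn_ge0.
have h1 : P ^+ 10 * (k10 * Z) <= T * Y * (k10 * Z).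
  by apply: ler_wpM2r P10; exact: mulr_ge0.
have h2 : y <= y * (T * Y * (k10 * Z)).
  by rewrite ler_peMr// (le_trans H10).
apply: (le_trans h2).
have -> : y * (T * Y * (k10 * Z)) = k10 * T * (Z * (Y * y)) by ring.
by rewrite ler_piMr// mulr_ge0.
Qed.

(** Both error terms are at most a constant times b^(-97), and b^97 >= b^95 = (b^5)^19 >= Q^(38
    d). *)
Lemma approx_error_le (M : R) (Q A d b : nat) : 0 <= M -> (0 < Q)%N -> (0 < b)%N ->
  (Q ^ (2 * d) <= b ^ 5)%N -> (b ^ 97 <= Q ^ A)%N ->
  2 * b%:R ^- tau + 4 * M * Q%:R ^- A <= (2 + 4 * M) / Q%:R ^+ (38 * d).
Proof.
move=> M0 Q0 b0 Qb bQ.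
have bR : 1 <= b%:R :> R by rewrite ler1n.
have QR : 0 < Q%:R :> R by rewrite ltr0n.
have b97 : Q%:R ^+ (38 * d) <= b%:R ^+ 97 :> R.
  apply: (@le_trans _ _ (b%:R ^+ 95)); last by rewrite ler_weXn2l.
  rewrite (exprM _ 5 19) (_ : 38 * d = 2 * d * 19)%N; last by rewrite mulnAC.
  by rewrite exprM lerXn2r ?nnegrE ?exprn_ge0// -!natrX ler_nat.
have h (z : R) : b%:R ^+ 97 <= z -> z^-1 <= (Q%:R ^+ (38 * d))^-1.
  move=> bz; rewrite lef_pV2 ?posrE ?exprn_gt0// ?(le_trans b97 bz)//.
  by rewrite (lt_le_trans _ bz)// exprn_gt0// (lt_le_trans ltr01).
rewrite [leRHS]mulrDl lerD ?ler_wpM2l ?mulr_ge0//.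
  by apply: h; rewrite /tau ler_weXn2l.
by apply: h; rewrite -!natrX ler_nat.
Qed.

(** The layer of denominators handled by [W f d]; comparing [b ^ 5] and [b ^ 97] with powers of [Q]
    keeps all exponents natural. *)
Definition near_curve (f : R -> R) (M c e : R) (A d Q : nat) : set R :=
  [set x | x \in `[c, e] /\ exists (p : int) (q : nat) (a : int) (b : nat),
    [/\ x = p%:~R / q%:R, (0 < q < 2 * Q)%N, (0 < b)%N,
      (Q ^ (2 * d) <= b ^ 5 <= Q ^ (2 * d + 2))%N /\ (b ^ 97 <= Q ^ A)%N &
      `|f x - a%:~R / b%:R| <= 2 * b%:R ^- tau + 4 * M * Q%:R ^- A]].

(** Each window of length Q^(-17/10) holds at most [n] points: otherwise [n] of them would give a
    nonzero determinant that is too small. *)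
Lemma near_curve_at_most (U : set R) (f : R -> R) (M c e : R) (A d : nat) :
  open U -> real_analytic_on U f -> `[c, e] `<=` U -> c < e -> 0 <= M -> (0 < d)%N ->
  (forall x, x \in `[c, e] -> W f d x != 0) ->
  exists (C : R) (Q0 : nat), [/\ 0 <= C, (0 < Q0)%N & forall Q, (Q0 <= Q)%N ->
    at_most (near_curve f M c e A d Q) (C * Q%:R `^ (17%:R / 10%:R))].
Proof.
move=> oU fU ceU ce M0 d0 W0.
pose n := (2 * d.+1)%N.
have n0 : (0 < n)%N by [].
pose phi (j : 'I_n) (x : R) := x ^+ (j %/ 2) * f x ^+ (j %% 2).
have phiU j : real_analytic_on U (phi j).
  by apply: analytic_monomial => //; rewrite ltn_mod.
have [del [eta [K [del0 eta0 K0 KP]]]] := det_near_values oU ceU ce n0 phiU W0.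
pose X := 1 + `|c| + `|e|.
have X1 : 1 <= X by rewrite /X -addrA lerDl addr_ge0.
have X0 : 0 <= X by exact: le_trans ler01 X1.
pose C1 := 8 ^+ n.-1 * (X ^+ n * (2 + 4 * M)).
have C10 : 0 <= C1.
  by rewrite /C1 !mulr_ge0 ?exprn_ge0// addr_ge0// mulr_ge0.
pose C2 := (K * (2 ^ d)%:R ^+ n) ^+ 10.
have C20 : 0 <= C2 by rewrite exprn_ge0// mulr_ge0 ?exprn_ge0// ltW.
(* A sum, so that Q exceeds each term: [C1 / eta] makes the perturbation admissible, [C2]
   contradicts [height_bound], and [del^-1] makes windows shorter than [del]. *)
pose T := C1 / eta + C2 + del^-1.
exists ((e - c + 1) * n%:R), (Num.truncn T).+1; split => //.
  by rewrite mulr_ge0// addr_ge0// subr_ge0 ltW.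
move=> Q TQ.
have {}TQ : T < Q%:R by rewrite (lt_le_trans (truncnS_gt _))// ler_nat.
have Q0 : 0 < Q%:R :> R.
  apply: le_lt_trans TQ; rewrite /T !addr_ge0 ?invr_ge0 ?divr_ge0//; exact: ltW.
have Q0n : (0 < Q)%N by rewrite -(ltr0n R).
have Q1 : 1 <= Q%:R :> R by rewrite ler1n.
have QC1 : C1 / eta <= Q%:R.
  have : 0 <= del^-1 by rewrite invr_ge0 ltW.
  by move: TQ; rewrite /T; lra.
have QC2 : C2 < Q%:R.
  have : 0 <= del^-1 by rewrite invr_ge0 ltW.
  have : 0 <= C1 / eta by rewrite divr_ge0// ltW.
  by move: TQ; rewrite /T; lra.
have Qdel : del^-1 <= Q%:R.
  have : 0 <= C1 / eta by rewrite divr_ge0// ltW.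
  by move: TQ; rewrite /T; lra.
set L := Q%:R `^ _.
have QL : Q%:R <= L by apply: le_powR_17_10; rewrite ?ler_weXn2l// ltW.
have L0 : 0 < L by exact: lt_le_trans QL.
pose l := L^-1.
have l0 : 0 < l by rewrite invr_gt0.
have ldel : l <= del.
  by rewrite -[leRHS]invrK lef_pV2 ?posrE ?invr_gt0// (le_trans Qdel QL).
have len0 : 0 <= e - c by rewrite subr_ge0 ltW.
apply: (@at_most_sub _ _ (near_curve f M c e A d Q) _ (((e - c) / l + 1) * n%:R)) => //.
  rewrite [leRHS]mulrAC ler_wpM2r// /l invrK [leRHS]mulrDl mul1r lerD2l.
  exact: le_trans Q1 QL.
apply: (@at_most_windows _ _ c) => // [x|u].
  by move=> [+ _]; rewrite in_itv/= [c + _]addrC subrK.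
apply: at_most_uniq => s us sS; rewrite leqNgt; apply/negP => ns.
(* The mean value form needs increasing nodes: sort the points and keep the first [n]. *)
pose t := sort <=%R s.
pose x i := nth 0 t i.
have tn : size t = size s by rewrite size_sort.
have tlt : sorted <%R t by rewrite lt_sorted_uniq_le sort_uniq us sort_le_sorted.
have xt i : (i < n)%N -> x i \in s.
  by move=> ni; rewrite -(mem_sort <=%R) mem_nth// tn (ltn_trans ni).
have xlt i j : (i < j < n)%N -> x i < x j.
  move=> /andP[ij jn]; apply: (sorted_ltn_nth lt_trans) => //.
    by rewrite inE tn (ltn_trans _ ns)// (ltn_trans ij).
  by rewrite inE tn (ltn_trans jn).
have xce i : (i < n)%N -> x i \in `[c, e] by move=> /xt/sS[[]].
have xu i : (i < n)%N -> u <= x i <= u + l by move=> /xt/sS[].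
have xl i j : (i < n)%N -> (j < n)%N -> `|x i - x j| <= l.
  move=> /xu/andP[? ?] /xu/andP[? ?]; rewrite ler_norml; lra.
have /choice[pqab pqabP] i : exists y : (int * nat) * (int * nat), (i < n)%N ->
    [/\ x i = y.1.1%:~R / y.1.2%:R, (0 < y.1.2 < 2 * Q)%N,
      (0 < y.2.2)%N,
      (Q ^ (2 * d) <= y.2.2 ^ 5 <= Q ^ (2 * d + 2))%N /\ (y.2.2 ^ 97 <= Q ^ A)%N &
      `|f (x i) - y.2.1%:~R / y.2.2%:R| <= 2 * y.2.2%:R ^- tau + 4 * M * Q%:R ^- A].
  have [/xt/sS[[_ [p [q [a [b H]]]]] _]|ni] := ltnP i n.
    by exists ((p, q), (a, b)).
  by exists ((0, 0%N), (0, 0%N)).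
pose p i := (pqab i).1.1; pose q i := (pqab i).1.2.
pose a i := (pqab i).2.1; pose b i := (pqab i).2.2.
pose y i : R := (a i)%:~R / (b i)%:R.
pose v (j : 'I_n) i := x i ^+ (j %/ 2) * y i ^+ (j %% 2).
(* The factor [X ^+ n] bounds the power of x that multiplies the approximation error in each
   monomial. *)
pose E := X ^+ n * ((2 + 4 * M) / Q%:R ^+ (38 * d)).
have XE : (2 + 4 * M) / Q%:R ^+ (38 * d) <= E.
  rewrite /E ler_peMl ?divr_ge0 ?exprn_ge0 ?addr_ge0 ?mulr_ge0//.
  by rewrite exprn_ege1.
have vE (j : 'I_n) i : (i < n)%N -> `|v j i - phi j (x i)| <= E.
  move=> ni; rewrite /v /phi -mulrBr normrM.
  have [_ _ b0 [/andP[Qb _] bQ] fy] := pqabP i ni.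
  have {}fy := le_trans fy (approx_error_le M0 Q0n b0 Qb bQ).
  have Xj : `|x i ^+ (j %/ 2)| <= X ^+ n.
    rewrite normrX; apply: (@le_trans _ _ (X ^+ (j %/ 2))).
      rewrite lerXn2r ?nnegrE// /X; have := xce _ ni; rewrite in_itv/= => /andP[x1 x2].
      have := ler_norm e; have := ler_norm (- c); rewrite normrN.
      have := normr_ge0 c; have := normr_ge0 e.
      by rewrite ler_norml; lra.
    apply: (ler_weXn2l X1).
    exact: leq_trans (leq_div _ _) (ltnW (ltn_ord j)).
  rewrite ler_pM//.
  have : (j %% 2 < 2)%N by rewrite ltn_mod.
  case: (j %% 2)%N => [_|[_|//]]; last by rewrite !expr1 distrC.
  by rewrite !expr0 subrr normr0 divr_ge0 ?exprn_ge0// addr_ge0 ?mulr_ge0.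
pose sp : R := (4 * Q%:R ^+ 2)^-1.
have sp0 : 0 < sp by rewrite invr_gt0 mulr_gt0 ?exprn_gt0.
have sp2 : sp <= 2.
  rewrite /sp invf_ple ?posrE ?mulr_gt0 ?exprn_gt0//.
  have : 1 <= Q%:R ^+ 2 :> R by rewrite exprn_ege1.
  lra.
have spx i j : (j < i < n)%N -> sp <= `|x i - x j|.
  move=> /andP[ji ni].
  have [xi qi _ _ _] := pqabP i ni.
  have [xj qj _ _ _] := pqabP j (ltn_trans ji ni).
  have xx : x i != x j by rewrite gt_eqF// xlt// ji.
  rewrite xi xj in xx *.
  exact: rational_separation qi qj xx.
have spE : (2 / sp) ^+ n.-1 * E <= eta.
  have -> : 2 / sp = 8 * Q%:R ^+ 2 by rewrite /sp invrK; ring.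
  have -> : (8 * Q%:R ^+ 2) ^+ n.-1 * E =
      C1 * (Q%:R ^+ (2 * n.-1) / Q%:R ^+ (38 * d)).
    by rewrite /C1 /E exprMn -exprM; ring.
  apply: (@le_trans _ _ (C1 / Q%:R)); last first.
    by rewrite ler_pdivrMr// mulrC -ler_pdivrMr.
  rewrite ler_wpM2l// ler_pdivrMr ?exprn_gt0// ler_pdivlMl// -exprS ler_weXn2l//.
  exact: exponent_gap.
have xdel : x n.-1 - x 0%N <= del.
  by apply: le_trans ldel; apply: le_trans (ler_norm _) (xl _ _ _ _); rewrite ?prednK.
have [] := KP x v sp E xlt xce xdel _ spx vE spE; first by rewrite sp0 sp2.
have -> : \matrix_(i < n, j < n) v j i = \matrix_(k < n, j < n)
    (((p k)%:~R / (q k)%:R : R) ^+ (j %/ 2) * ((a k)%:~R / (b k)%:R) ^+ (j %% 2)).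
  apply/matrixP => i j; rewrite !mxE /v.
  by have [-> _ _ _ _] := pqabP i (ltn_ord i).
move=> D0 DK.
have qb0 k : (k < n)%N -> (0 < q k)%N && (0 < b k)%N.
  by move=> kn; have [_ /andP[-> _] -> _ _] := pqabP k kn.
(* If integrality held together with [DK] and gaps at most [l], [height_bound] would give
   [Q <= C2]. *)
have := @det_rational_ge R d p a q b qb0 D0; apply/negP; rewrite -ltNge.
apply: contraTlt QC2 => D1; rewrite -leNgt.
apply: (@height_bound d Q q b K l) => //.
- exact: ltW.
- exact: ltW.
- by rewrite -powR_17_10 -/L -exprMn /l mulVf ?expr1n// gt_eqF.
- by move=> k kn; have [_ /andP[_ /ltnW ?] _ _ _] := pqabP k kn.
- by move=> k kn; have [_ _ _ [/andP[_ ?] _] _] := pqabP k kn.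
apply: (le_trans D1); rewrite ler_wpM2l//.
  by apply: prodr_ge0 => k _; rewrite mulr_ge0 ?exprn_ge0.
apply: (le_trans DK); rewrite ler_wpM2l ?(ltW K0)//.
apply: prod_dist_le => i j /andP[ji ni]; apply: xl => //.
exact: ltn_trans ni.
Qed.

End large_denominators.

(** * Small denominators: one fraction at a time *)

Section small_denominators.
Context {R : realType}.

(** Pull out H^(-97) and compare the remaining i^(-2) with 1/(i - 1) - 1/i, which telescopes to at
    most 1/(H - 1) <= 2/H. *)
Lemma sum_inv_pow99_le (H n : nat) : (2 <= H)%N ->
  \sum_(H <= i < n) (i%:R ^- 99 : R) <= 2 * H%:R ^- 98.
Proof.
move=> H2; have H0 : 0 < H%:R :> R by rewrite ltr0n ltnW.
have H2R : 2 <= H%:R :> R by rewrite ler_nat.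
have [nH|Hn] := leqP n H.
  by rewrite big_geq// mulr_ge0// invr_ge0 exprn_ge0.
pose g k : R := - (k%:R - 1)^-1.
have gE i : (H <= i < n)%N -> i%:R ^- 99 <= H%:R ^- 97 * (g i.+1 - g i).
  move=> /andP[Hi _].
  have iR : H%:R <= i%:R :> R by rewrite ler_nat.
  have i0 : 0 < i%:R :> R by exact: lt_le_trans iR.
  have i1 : 0 < i%:R - 1 :> R by lra.
  have -> : g i.+1 - g i = (i%:R * (i%:R - 1))^-1.
    by rewrite /g -natr1 addrK; field; rewrite !gt_eqF.
  rewrite (exprD _ 97 2) invfM ler_pM ?invr_ge0 ?exprn_ge0 ?(ltW i0)//.
    by rewrite lef_pV2 ?posrE ?exprn_gt0// lerXn2r ?nnegrE// ltW.
  by rewrite lef_pV2 ?posrE ?exprn_gt0 ?mulr_gt0// expr2 ler_pM2l//; lra.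
apply: (@le_trans _ _ (\sum_(H <= i < n) H%:R ^- 97 * (g i.+1 - g i))).
  by apply: ler_sum_nat => i /gE.
rewrite -mulr_sumr telescope_sumr; last exact: ltnW.
have nR : H%:R < n%:R :> R by rewrite ltr_nat.
have gn : g n <= 0 by rewrite /g oppr_le0 invr_ge0; lra.
have gH : - g H <= 2 / H%:R.
  by rewrite /g opprK ler_pdivlMr// mulrC ler_pdivrMr; lra.
rewrite (exprD _ 97 1) [in leRHS]invfM [leRHS]mulrCA ler_wpM2l ?invr_ge0 ?exprn_ge0//.
rewrite expr1; lra.
Qed.

(** By the mean value theorem [f] expands distances by at least [m], so [S] lies within
    [2 * delta / m] of any of its points; then count fractions spaced by 1/(4 Q^2). *)
Lemma level_set_at_most (f : R -> R) (a b m z delta : R) (Q : nat) (S : set R) :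
  (0 < Q)%N -> 0 < m -> 0 <= delta ->
  (forall x, x \in `[a, b] -> derivable f x 1) ->
  (forall x, x \in `[a, b] -> m <= `|(f^`())%classic x|) ->
  (forall x, S x -> x \in `[a, b] /\ exists (p : int) (q : nat),
     x = p%:~R / q%:R /\ (0 < q < 2 * Q)%N) ->
  (forall x, S x -> `|f x - z| <= delta) ->
  at_most S (16 * Q%:R ^+ 2 * delta / m + 1).
Proof.
move=> Q0 m0 de0 fd fm Sab Sz.
have Q0R : 0 < Q%:R :> R by rewrite ltr0n.
have [[x0 Sx0]|S0] := pselect (exists x, S x); last first.
  apply: (@at_most_sub _ _ S _ 0) => //.
    by rewrite addr_ge0// divr_ge0 ?mulr_ge0 ?exprn_ge0// ltW.
  by exists [::] => // x Sx; exfalso; apply: S0; exists x.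
have expand x y : x \in `[a, b] -> y \in `[a, b] -> m * `|x - y| <= `|f x - f y|.
  wlog yx : x y / y <= x => [H xab yab|].
    have [yx|/ltW xy] := leP y x; first exact: H.
    by rewrite distrC [leRHS]distrC; exact: H.
  move=> xab yab.
  have sub s : s \in `[y, x] -> s \in `[a, b].
    by move: xab yab; rewrite !in_itv/= => /andP[? ?] /andP[? ?] /andP[? ?]; lra.
  have [s||s sxy ->] := @MVT_segment R f (f^`())%classic y x yx.
  - move=> /subset_itv_oo_cc/sub/fd sd; rewrite derive1E; exact: derivableP.
  - by apply: derivable_within_continuous => s /sub; exact: fd.
  by rewrite normrM ler_wpM2r// fm// sub.
have Sx x : S x -> x0 - 2 * delta / m <= x <= x0 - 2 * delta / m + 4 * delta / m.
  move=> Sx; have h1 := Sz x Sx; have h2 := Sz x0 Sx0.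
  have := expand x x0 (Sab x Sx).1 (Sab x0 Sx0).1.
  have h3 : `|f x - f x0| <= 2 * delta.
    by rewrite (le_trans (ler_distD z _ _))// [X in _ + X]distrC; lra.
  move=> /le_trans/(_ h3); rewrite mulrC -ler_pdivlMr// ler_norml => /andP[h4 h5].
  have -> : 4 * delta / m = 2 * (2 * delta / m) by ring.
  lra.
have -> : 16 * Q%:R ^+ 2 * delta / m = 4 * delta / m / (4 * Q%:R ^+ 2)^-1.
  by rewrite invrK; ring.
apply: at_most_separated Sx _.
- by rewrite invr_gt0 mulr_gt0 ?exprn_gt0.
- by rewrite divr_ge0 ?mulr_ge0// ltW.
move=> x y /Sab[_ [p [q [-> q2]]]] /Sab[_ [p' [q' [-> q2']]]] xy.
exact: rational_separation q2 q2' xy.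
Qed.

Definition coarse_near_curve (f : R -> R) (M a b : R) (A H Q : nat) : set R :=
  [set x | x \in `[a, b] /\ exists (p : int) (q : nat) (n : int) (k : nat),
    [/\ x = p%:~R / q%:R, (0 < q < 2 * Q)%N, (0 < k)%N && (H <= k)%N,
      (k ^ 5 <= Q ^ 4)%N &
      `|f x - n%:~R / k%:R| <= 2 * k%:R ^- tau + 4 * M * Q%:R ^- A]].

(** Each [k] has O(k) numerators. The part k^(-100) of the error sums to Q^2 H^(-98); the part
    Q^(-A), tamed by [2 <= A], and the additive 1 contribute O(k) for each [k]. *)
Lemma coarse_near_curve_at_most (f : R -> R) (a b m M : R) :
  0 < m -> 0 <= M -> (forall x, x \in `[a, b] -> derivable f x 1) ->
  (forall x, x \in `[a, b] -> m <= `|(f^`())%classic x|) ->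
  exists Clow C : R, [/\ 0 < Clow, 0 <= C & forall A H Q : nat,
    (2 <= A)%N -> (2 <= H)%N -> (0 < Q)%N ->
    at_most (coarse_near_curve f M a b A H Q)
      (Clow * Q%:R ^+ 2 * H%:R ^- 98 + C * Q%:R `^ (17%:R / 10%:R))].
Proof.
move=> m0 M0 fd fm.
have [F F0 FP] := bounded_on_segment (derivable_within_continuous fd).
(* An integer bound for the fractions n/k: [F] bounds [|f|] and [2 + 4 * M] bounds the error. *)
pose G := (Num.truncn (F + 2 + 4 * M)).+1.
have GP : F + 2 + 4 * M <= G%:R by exact: ltW (truncnS_gt _).
have G1 : 1 <= G%:R :> R by rewrite ler1n.
have G0 : 0 < G%:R :> R by exact: lt_le_trans ltr01 G1.
exists (192 * G%:R / m), (3 * G%:R * (64 * M / m + 1)); split.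
- by rewrite divr_gt0 ?mulr_gt0.
- by rewrite !mulr_ge0 ?addr_ge0 ?divr_ge0 ?mulr_ge0 ?(ltW m0).
move=> A H Q A2 H2 Q0.
have Q0R : 0 < Q%:R :> R by rewrite ltr0n.
have Q1R : 1 <= Q%:R :> R by rewrite ler1n.
set L := Q%:R `^ _; have L0 : 0 <= L by exact: powR_ge0.
(* The cutoff is of size Q^(17/20), so [K * K <= L]. It covers every [k] with [k ^ 5 <= Q ^ 4],
   since then k^20 <= Q^16 <= Q^17. *)
pose K := Num.truncn (Num.sqrt L).
have KL : K%:R * K%:R <= L.
  have KsL : K%:R <= Num.sqrt L by rewrite truncn_le sqrtr_ge0.
  by rewrite -(sqr_sqrtr L0) expr2 ler_pM.
pose delta (k : nat) : R := 2 * k%:R ^- tau + 4 * M * Q%:R ^- A.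
have delta0 k : 0 <= delta k.
  by rewrite addr_ge0 ?mulr_ge0 ?invr_ge0 ?exprn_ge0.
pose S (k : nat) (n : int) : set R := [set x | x \in `[a, b] /\
  exists (p : int) (q : nat), (x = p%:~R / q%:R /\ (0 < q < 2 * Q)%N) /\
    `|f x - n%:~R / k%:R| <= delta k].
have SP k n : at_most (S k n) (16 * Q%:R ^+ 2 * delta k / m + 1).
  apply: (@level_set_at_most f a b m (n%:~R / k%:R)) => //.
  - by move=> x [xab [p [q [pq _]]]]; split=> //; exists p, q.
  - by move=> x [_ [p [q []]]].
pose r k : R := (2 * k * G).+1%:R * (16 * Q%:R ^+ 2 * delta k / m + 1).
(* All integers from -kG to kG. *)
pose num (k : nat) := [seq (i%:Z - (k * G)%:Z)%R | i <- iota 0 (2 * k * G).+1].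
have SkP k : at_most [set x | exists2 n, n \in num k & S k n x] (r k).
  have -> : r k = (16 * Q%:R ^+ 2 * delta k / m + 1) *+ (2 * k * G).+1.
    by rewrite -[RHS]mulr_natl.
  have := @at_most_bigcup _ _ (num k) (S k) _ (fun n _ => SP k n).
  by rewrite big_const_seq count_predT size_map size_iota iter_addr_0.
have := at_most_bigcup (fun k (_ : k \in index_iota H K.+1) => SkP k).
apply: at_most_sub.
  move=> x [xab [p [q [n [k [xpq q2 /andP[k0 Hk] kQ fk]]]]]].
  have k0R : 0 < k%:R :> R by rewrite ltr0n.
  have k1R : 1 <= k%:R :> R by rewrite ler1n.
  exists k.
    rewrite mem_index_iota Hk/= ltnS truncn_ge_nat ?sqrtr_ge0//.
    rewrite -[leLHS]ger0_norm// -sqrtr_sqr ler_sqrt//.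
    apply: le_powR_17_10; first exact: exprn_ge0.
    rewrite -exprM (_ : 2 * 10 = 5 * 4)%N// exprM.
    apply: (@le_trans _ _ ((Q%:R ^+ 4) ^+ 4)).
      by rewrite lerXn2r ?nnegrE ?exprn_ge0// -!natrX ler_nat.
    by rewrite -exprM ler_weXn2l.
  exists n; last by split=> //; exists p, q.
  have d1 : delta k <= 2 + 4 * M.
    rewrite /delta lerD// ?ler_piMr// ?mulr_ge0//.
      by rewrite invf_le1 ?exprn_gt0// exprn_ege1.
    by rewrite invf_le1 ?exprn_gt0// exprn_ege1.
  have nk : `|n%:~R : R| <= (k * G)%:R.
    have h : `|n%:~R / k%:R| <= G%:R :> R.
      apply: le_trans GP.
      have -> : n%:~R / k%:R = f x - (f x - n%:~R / k%:R) :> R by rewrite opprB addrC subrK.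
      rewrite (le_trans (ler_normB _ _))// -addrA lerD// ?FP//.
      exact: le_trans fk d1.
    by move: h; rewrite normrM normfV (ger0_norm (ltW k0R)) ler_pdivrMr// natrM mulrC.
  have {}nk : (absz n <= k * G)%N.
    by move: nk; rewrite -intr_norm -abszE -[leLHS]/(`|n|%N%:R) ler_nat.
  apply/mapP; exists (absz (n + (k * G)%:Z)%R).
    by rewrite mem_iota/=; clearbody G; clear -nk; lia.
  by clearbody G; clear -nk; lia.
have rk k : (H <= k < K.+1)%N ->
    r k <= 96 * G%:R / m * Q%:R ^+ 2 * k%:R ^- 99 + 3 * G%:R * (64 * M / m + 1) * K%:R.
  move=> /andP[Hk kK].
  have k0 : (0 < k)%N by apply: leq_trans Hk; exact: ltnW.
  have k1R : 1 <= k%:R :> R by rewrite ler1n.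
  have kKR : k%:R <= K%:R :> R by rewrite ler_nat.
  have k3 : (2 * k * G).+1%:R <= 3 * G%:R * k%:R :> R.
    have : 1 <= G%:R * k%:R :> R by exact: mulr_ege1.
    by rewrite -natr1 !natrM; lra.
  have dk0 : 0 <= 16 * Q%:R ^+ 2 * delta k / m + 1.
    by rewrite addr_ge0 ?divr_ge0 ?mulr_ge0 ?exprn_ge0 ?delta0// ltW.
  apply: (le_trans (ler_wpM2r dk0 k3)).
  have QA : Q%:R ^+ 2 * Q%:R ^- A <= 1 :> R.
    by rewrite ler_pdivrMr ?exprn_gt0// mul1r ler_weXn2l.
  have k99 : k%:R * k%:R ^- tau = k%:R ^- 99 :> R.
    rewrite /tau (exprS _ 99) invfM mulrA divff ?mul1r//.
    by rewrite gt_eqF// (lt_le_trans ltr01).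
  have -> : 3 * G%:R * k%:R * (16 * Q%:R ^+ 2 * delta k / m + 1) =
      96 * G%:R / m * Q%:R ^+ 2 * k%:R ^- 99 +
      3 * G%:R * (64 * M / m * (Q%:R ^+ 2 * Q%:R ^- A) + 1) * k%:R.
    rewrite -k99 /delta; set y := k%:R ^- tau; set w := Q%:R ^- A; ring.
  rewrite lerD2l ler_pM// ?mulr_ge0 ?addr_ge0 ?divr_ge0 ?mulr_ge0 ?invr_ge0
    ?exprn_ge0 ?(ltW m0)//.
  rewrite ler_wpM2l ?mulr_ge0// lerD2r ler_piMr// divr_ge0 ?mulr_ge0//.
  exact: ltW.
apply: (@le_trans _ _ (\sum_(H <= k < K.+1) (96 * G%:R / m * Q%:R ^+ 2 * k%:R ^- 99 +
    3 * G%:R * (64 * M / m + 1) * K%:R))).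
  by apply: ler_sum_nat => k; exact: rk.
rewrite big_split/= -mulr_sumr lerD//.
  have -> : 192 * G%:R / m * Q%:R ^+ 2 * H%:R ^- 98 =
      96 * G%:R / m * Q%:R ^+ 2 * (2 * H%:R ^- 98) by ring.
  rewrite ler_wpM2l ?sum_inv_pow99_le//.
  by rewrite !mulr_ge0 ?invr_ge0 ?exprn_ge0 ?(ltW m0).
set Z := 3 * _ * _; have Z0 : 0 <= Z.
  by rewrite !mulr_ge0 ?addr_ge0 ?mulr_ge0 ?invr_ge0 ?(ltW m0).
rewrite sumr_const_nat -mulrnAr ler_wpM2l// -[leLHS]mulr_natr.
apply: le_trans KL; rewrite ler_wpM2l// ler_nat.
by rewrite leq_subLR -add1n leq_add2r ltnW.
Qed.

End small_denominators.

(** * Choice of the degree and assembly of the two ranges *)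

Lemma le_Dpar (A d : nat) : (97 * d <= 10 * A)%N -> (d <= Dpar A)%N.
Proof.
move=> dA; rewrite /Dpar leq_max; apply/orP; right.
set z : rat := _ / _.
have dz : d%:R <= z.
  by rewrite /z ler_pdivlMr ?ltr0n// -natrM ler_nat mulnC.
have : (d%:Z <= Num.ceil z)%R by rewrite -(ler_int rat) (le_trans dz)// ceil_ge.
by case: (Num.ceil z) => // k; rewrite lez_nat.
Qed.

Lemma lt_Tpar (R : realType) (Q A b : nat) :
  b%:R < Tpar R Q A -> (b ^ 97 < Q ^ A)%N.
Proof.
move=> bT; rewrite -(ltr_nat R) !natrX.
have -> : Q%:R ^+ A = Tpar R Q A ^+ 97.
  rewrite /Tpar -[RHS]powR_mulrn ?powR_ge0// -powRrM divfK ?pnatr_eq0//.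
  by rewrite powR_mulrn.
by rewrite ltrXn2r// nnegrE powR_ge0.
Qed.

(** Take for d the integer logarithm of b^5 in base Q^2. Comparing Q^(2d * 97) <= b^(5 * 97) with
    b^97 < Q^A gives 194 d <= 5 A. *)
Lemma degree_range (Q A b : nat) : (1 < Q)%N -> (0 < b)%N ->
  (Q ^ 4 <= b ^ 5)%N -> (b ^ 97 < Q ^ A)%N ->
  exists2 d, (2 <= d <= Dpar A)%N & (Q ^ (2 * d) <= b ^ 5 <= Q ^ (2 * d + 2))%N.
Proof.
move=> Q1 b0 Qb bQ.
have Q21 : (1 < Q ^ 2)%N by rewrite (ltn_exp2l 0).
have b50 : (0 < b ^ 5)%N by rewrite expn_gt0 b0.
exists (trunc_log (Q ^ 2) (b ^ 5)); last first.
  have /andP[h1 h2] := trunc_log_bounds Q21 b50.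
  rewrite expnM h1/= ltnW//.
  by move: h2; rewrite -expnM mulnS addnC.
apply/andP; split; first by rewrite trunc_log_max// -expnM.
set d := trunc_log _ _.
have h1 : (Q ^ (2 * d) <= b ^ 5)%N by rewrite expnM trunc_logP.
apply: le_Dpar.
have h2 : (2 * d * 97 <= A * 5)%N.
  rewrite -(leq_exp2l _ _ Q1) [X in (X <= _)%N]expnM [X in (_ <= X)%N]expnM.
  apply: (@leq_trans ((b ^ 97) ^ 5)); last by rewrite leq_exp2r// ltnW.
  by rewrite [X in (_ <= X)%N]expnAC leq_exp2r.
move: h2; move: d {h1} => d; lia.
Qed.

Theorem proposition5p1 (R : realType) (U : set R) (f : R -> R) (a b m M : R)
    (oU : open U) (iU : is_interval U)
    (fU : real_analytic_on U f) (ratf : ~ rational_on U f)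
    (ab : a < b) (abU : `[a, b] `<=` U)
    (m0 : 0 < m) (mfM : forall x, x \in `[a, b] -> m <= `|derive1 f x| <= M) :
  exists2 Clow : R, 0 < Clow &
    forall (c e : R) (A : nat), c < e -> `[c, e] `<=` `[a, b] -> (3 <= A)%N ->
      (forall x d, x \in `[c, e] -> (2 <= d <= Dpar A)%N -> W f d x != 0) ->
      exists (C : R) (Q0 : nat), [/\ 0 < C, (0 < Q0)%N &
        forall H Q : nat, (2 <= H)%N -> (Q0 <= Q)%N ->
          finite_set (Dset f M `[c, e] Q A H) /\
          #|` fset_set (Dset f M `[c, e] Q A H)|%:R
            <= Clow * Q%:R ^+ 2 * H%:R ^- 98 + C * Q%:R `^ (17%:R / 10%:R)].
Proof.
have fd x : x \in `[a, b] -> derivable f x 1.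
  by move=> xab; apply: (analytic_derive fU).1; exact: abU.
have M0 : 0 < M.
  have /mfM/andP[mf fM] : a \in `[a, b] by rewrite in_itv/= lexx ltW.
  exact: lt_le_trans m0 (le_trans mf fM).
have fm x : x \in `[a, b] -> m <= `|(f^`())%classic x| by move=> /mfM/andP[].
(* Applied on all of [[a, b]], before [c], [e] and [A] appear, so [Clow] does not depend on them. *)
have [Clow [C' [Clow0 C'0 low]]] := coarse_near_curve_at_most m0 (ltW M0) fd fm.
exists Clow => // c e A ce ceab A3 W0.
have ceU : `[c, e] `<=` U := subset_trans ceab abU.
(* Constants for all degrees are fixed before [H] and [Q]; degrees out of range get a default
   pair. *)
have /choice[CQ CQP] d : exists y : R * nat, (2 <= d <= Dpar A)%N ->
    0 <= y.1 /\ forall Q, (y.2 <= Q)%N ->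
    at_most (near_curve f M c e A d Q) (y.1 * Q%:R `^ (17%:R / 10%:R)).
  have [dA|dA] := boolP (2 <= d <= Dpar A)%N; last by exists (0, 0%N).
  have d0 : (0 < d)%N by case/andP: dA => /ltnW.
  have [C [Q0 [C0 _ CP]]] := near_curve_at_most A oU fU ceU ce (ltW M0) d0
    (fun x xce => W0 x d xce dA).
  by exists (C, Q0).
pose ds := index_iota 2 (Dpar A).+1.
have dsP d : d \in ds -> (2 <= d <= Dpar A)%N by rewrite mem_index_iota.
have C0 : 0 <= \sum_(d <- ds) (CQ d).1.
  by rewrite big_seq sumr_ge0// => d /dsP/CQP[].
(* The 1 makes the constant positive; the 2 ensures [1 < Q], as the logarithm in [degree_range]
   requires. *)
exists (C' + \sum_(d <- ds) (CQ d).1 + 1), (\sum_(d <- ds) (CQ d).2 + 2)%N.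
split; [by rewrite ltr_wpDl// addr_ge0|by rewrite addn_gt0 orbT|].
move=> H Q H2 QQ.
have Q1 : (1 < Q)%N by apply: leq_trans QQ; rewrite leq_addl.
have Q0 : (0 < Q)%N := ltnW Q1.
have Qd d : d \in ds -> ((CQ d).2 <= Q)%N.
  move=> dds; apply: leq_trans QQ; apply: leq_trans (leq_addr _ _).
  by rewrite (big_rem d)//= leq_addr.
set L := Q%:R `^ _.
have L0 : 0 <= L by exact: powR_ge0.
apply: at_most_card.
have hi d : d \in ds -> at_most (near_curve f M c e A d Q) ((CQ d).1 * L).
  by move=> dds; have [_] := CQP d (dsP d dds); apply; exact: Qd.
apply: at_most_sub (at_mostU (low A H Q (ltnW A3) H2 Q0) (at_most_bigcup hi)).
  move=> x [xce [p [q [xpq _ /andP[Qq qQ] [n [k [k0 Hk kT fk]]]]]]].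
  have q02 : (0 < q < 2 * Q)%N by rewrite (leq_trans Q0 Qq).
  have kQ := lt_Tpar kT.
  have [k5|k5] := leqP (k ^ 5) (Q ^ 4).
    left; split; first exact: ceab.
    by exists p, q, n, k; split=> //; rewrite k0.
  have [d dA Qdk] := degree_range Q1 k0 (ltnW k5) kQ.
  right; exists d; first by rewrite mem_index_iota.
  split; first by [].
  by exists p, q, n, k; split=> //; split=> //; exact: ltnW.
by rewrite -mulr_suml -addrA lerD2l -mulrDl ler_wpM2r// lerDl.
Qed.
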